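(* Let $K$ be a field of characteristic zero and let $\mathbb{I}_1 = K\langle x, \partial, \int\rangle$ be the algebra of polynomial integro-differential operators in one variable. Then $\mathrm{w.dim}(Q_l(\mathbb{I}_1)) = 0$ and $\mathrm{w.dim}(Q_r(\mathbb{I}_1)) = 0$, where $Q_l(\mathbb{I}_1)$ and $Q_r(\mathbb{I}_1)$ are the largest left and the largest right quotient rings of $\mathbb{I}_1$.
   Context: $\mathbb{I}_1$ is the $K$-subalgebra of $\mathrm{End}_K(K[x])$ generated by multiplication by $x$, the derivation $\partial = d/dx$, and the integration $\int : x^{m}\mapsto \frac{x^{m+1}}{m+1}$ ($m\ge 0$). An element of a ring $R$ is regular if it is neither a left nor a right zero divisor. Every ring $R$ has a largest (with respect to inclusion) left Ore set consisting of regular elements, denoted $S_l(R)$, and a largest right Ore set consisting of regular elements, denoted $S_r(R)$. The rings $Q_l(R) := S_l(R)^{-1}R$ and $Q_r(R) := R S_r(R)^{-1}$ are called the (largest) left, respectively right, quotient ring of $R$. $\mathrm{w.dim}$ denotes the weak global dimension of a ring. *)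

(* Defs.v *)
From HB Require Import structures.
From mathcomp Require Import all_boot all_order all_algebra generic_quotient.
From mathcomp Require Import boolp classical_sets.

Set Implicit Arguments.
Unset Strict Implicit.
Unset Printing Implicit Defensive.

Import GRing.Theory.
Local Open Scope ring_scope.
Local Open Scope quotient_scope.
Local Open Scope classical_set_scope.

Section OreSets.
Variable R : nzRingType.

Definition regular_elt (x : R) : Prop := GRing.lreg x /\ GRing.rreg x.

Record multiplicative_set (S : set R) : Prop := MultiplicativeSet {
  mset1 : S 1;
  msetN0 : ~ S 0;
  msetM : forall s t, S s -> S t -> S (s * t) }.

Definition left_Ore_set (S : set R) : Prop :=
  multiplicative_set S /\
  forall r s, S s -> exists s' r', S s' /\ s' * r = r' * s.

Definition right_Ore_set (S : set R) : Prop :=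
  multiplicative_set S /\
  forall r s, S s -> exists s' r', S s' /\ r * s' = s * r'.

Definition regular_left_Ore_set (S : set R) : Prop :=
  left_Ore_set S /\ (forall s, S s -> regular_elt s).

Definition regular_right_Ore_set (S : set R) : Prop :=
  right_Ore_set S /\ (forall s, S s -> regular_elt s).

(* The unions below are themselves regular Ore sets, hence the largest ones:
   see Sl_Ore, Sl_max, Sr_Ore and Sr_max. *)
Definition Sl : set R := \bigcup_(S in [set S | regular_left_Ore_set S]) S.
Definition Sr : set R := \bigcup_(S in [set S | regular_right_Ore_set S]) S.

Lemma regular_elt_neq0 (x : R) : regular_elt x -> x <> 0.
Proof.
move=> [rx _] x0; have /eqP := oner_neq0 R; apply.
by apply: rx; rewrite x0 !mul0r.
Qed.

Lemma regular_elt1 : regular_elt 1.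
Proof. by split; [exact: lreg1 | exact: rreg1]. Qed.

Lemma regular_eltM (x y : R) :
  regular_elt x -> regular_elt y -> regular_elt (x * y).
Proof. by move=> [? ?] [? ?]; split; [exact: lregM | exact: rregM]. Qed.

Inductive Ore_monoid : R -> Prop :=
| Ore_monoid1 : Ore_monoid 1
| Ore_monoidM S s t : regular_left_Ore_set S -> S s -> Ore_monoid t ->
    Ore_monoid (s * t).

Lemma Ore_monoid_Ore : regular_left_Ore_set (Ore_monoid : set R).
Proof.
have reg s : Ore_monoid s -> regular_elt s.
  elim=> [|S {}s t HS Ss _ IH]; first exact: regular_elt1.
  by apply: regular_eltM => //; apply: HS.2.
have omM s t : Ore_monoid s -> Ore_monoid t -> Ore_monoid (s * t).
  move=> Hs Ht; elim: Hs => [|S {}s u HS Ss _ IH]; first by rewrite mul1r.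
  by rewrite -mulrA; exact: (Ore_monoidM HS Ss IH).
split=> //; split; first split=> //.
- exact: Ore_monoid1.
- by move/reg/regular_elt_neq0; apply.
move=> r s Hs; elim: Hs r => [|S {}s t HS Ss _ IH] r.
  by exists 1, r; split; [exact: Ore_monoid1 | rewrite mul1r mulr1].
have [s1 [r1 [Hs1 E1]]] := IH r.
have [s2 [r2 [Hs2 E2]]] := HS.1.2 r1 s Ss.
exists (s2 * s1), r2; split.
  exact: (Ore_monoidM HS Hs2 Hs1).
by rewrite -mulrA E1 mulrA E2 mulrA.
Qed.

Lemma Sl_max (S : set R) : regular_left_Ore_set S -> S `<=` Sl.
Proof. by move=> HS s Ss; exists S. Qed.

Lemma Sl_Ore : regular_left_Ore_set Sl.
Proof.
suff -> : Sl = (Ore_monoid : set R) by exact: Ore_monoid_Ore.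
apply/seteqP; split=> [s [S HS Ss]|]; last exact: Sl_max Ore_monoid_Ore.
by rewrite -(mulr1 s); apply: (Ore_monoidM HS) => //; exact: Ore_monoid1.
Qed.

End OreSets.
Arguments Sl : clear implicits.
Arguments Sr : clear implicits.

Lemma regular_right_Ore_setE (R : nzRingType) (S : set R) :
  regular_right_Ore_set S <-> regular_left_Ore_set (S : set R^c).
Proof.
split=> -[[[S1 S0 SM] ore] reg]; (split; [split; [split=> //|]|]) => //.
- by move=> s t Ss St; exact: (SM t s).
- by move=> s /reg [? ?]; split.
- by move=> s t Ss St; exact: (SM t s).
- by move=> s /reg [? ?]; split.
Qed.

Lemma SrE (R : nzRingType) : Sr R = (Sl R^c : set R).
Proof.
by apply/seteqP; split=> s [S /regular_right_Ore_setE HS Ss]; exists S.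
Qed.

Lemma Sr_max (R : nzRingType) (S : set R) :
  regular_right_Ore_set S -> S `<=` Sr R.
Proof. by move=> HS s Ss; exists S. Qed.

Lemma Sr_Ore (R : nzRingType) : regular_right_Ore_set (Sr R).
Proof. by apply/regular_right_Ore_setE; rewrite SrE; exact: Sl_Ore. Qed.

(* The ring S^-1 R of left fractions s^-1 r. *)
Section LeftFractions.
Variables (R : nzRingType) (S : set R) (HS : regular_left_Ore_set S).

Record lfrac := LFrac { lden : R; lnum : R; ldenP : S lden }.
HB.instance Definition _ := gen_eqMixin lfrac.
HB.instance Definition _ := gen_choiceMixin lfrac.

Let S1 : S 1. Proof. exact: (mset1 HS.1.1). Qed.
Let SM s t : S s -> S t -> S (s * t). Proof. exact: (msetM HS.1.1). Qed.
Let ore r s : S s -> exists s' r', S s' /\ s' * r = r' * s.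
Proof. exact: HS.1.2. Qed.
Let rS s : S s -> GRing.rreg s. Proof. by move=> /HS.2[]. Qed.

Definition lfrac_eqP (p q : lfrac) : Prop := exists a b,
  [/\ S (a * lden p), a * lden p = b * lden q & a * lnum p = b * lnum q].
Definition lfrac_eq (p q : lfrac) : bool := `[< lfrac_eqP p q >].

Lemma lfrac_eq_refl : reflexive lfrac_eq.
Proof.
by move=> p; apply/asboolP; exists 1, 1; rewrite mul1r; split=> //; exact: ldenP.
Qed.

Lemma lfrac_eq_sym : symmetric lfrac_eq.
Proof.
move=> p q; apply/asboolP/asboolP => -[a [b [Sa Ed En]]];
  by exists b, a; rewrite -Ed.
Qed.

Lemma lfrac_eq_trans : transitive lfrac_eq.
Proof.
move=> q p r /asboolP[a [b [Sa Ed En]]] /asboolP[c [e [Sc Ed' En']]].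
apply/asboolP; have [k [h [Sk]]] := ore (b * lden q) Sc.
rewrite !mulrA => /(rS (ldenP q)) E.
exists (k * a), (h * e); rewrite -!mulrA; split; first exact: SM.
  by rewrite Ed -Ed' !mulrA E.
by rewrite En -En' !mulrA E.
Qed.

Definition lfrac_equiv :=
  EquivRel lfrac_eq lfrac_eq_refl lfrac_eq_sym lfrac_eq_trans.
Canonical lfrac_equiv.

Definition lfrac_ring : Type := {eq_quot lfrac_eq}.
HB.instance Definition _ := Choice.on lfrac_ring.

Local Notation Q := lfrac_ring.
Let cl (p : lfrac) : Q := \pi_({eq_quot lfrac_eq}) p.
Let rp (q : Q) : lfrac := repr (q : {eq_quot lfrac_eq}).

Lemma lfrac_clP p q : cl p = cl q <-> lfrac_eqP p q.
Proof.
split; first by move=> /eqmodP /asboolP.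
by move=> H; apply/eqmodP; apply/asboolP.
Qed.

Lemma lfrac_rpK q : cl (rp q) = q. Proof. exact: reprK. Qed.

Lemma lfrac_add_subproof (p q : lfrac) : exists ab : R * R,
  S (ab.1 * lden p) /\ ab.1 * lden p = ab.2 * lden q.
Proof.
have [a [b [Sa E]]] := ore (lden p) (ldenP q).
by exists (a, b); split=> //; apply: SM => //; exact: ldenP.
Qed.

Lemma lfrac_mul_subproof (p q : lfrac) : exists uc : R * R,
  S uc.1 /\ uc.1 * lnum p = uc.2 * lden q.
Proof.
by have [u [c [Su E]]] := ore (lnum p) (ldenP q); exists (u, c).
Qed.

(* s^-1 r + t^-1 q = (a s)^-1 (a r + b q)  where a s = b t in S. *)
Definition lfrac_add (p q : lfrac) : lfrac :=
  let: exist ab H := cid (lfrac_add_subproof p q) in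
  LFrac (ab.1 * lnum p + ab.2 * lnum q) H.1.

(* s^-1 r * t^-1 q = (u s)^-1 (c q)  where u r = c t and u in S. *)
Definition lfrac_mul (p q : lfrac) : lfrac :=
  let: exist uc H := cid (lfrac_mul_subproof p q) in
  LFrac (uc.2 * lnum q) (SM H.1 (ldenP p)).

Definition lfrac_opp (p : lfrac) : lfrac := LFrac (- lnum p) (ldenP p).

Definition lfrac_in (r : R) : Q := cl (LFrac r S1).

Let addQ (x y : Q) : Q := cl (lfrac_add (rp x) (rp y)).
Let mulQ (x y : Q) : Q := cl (lfrac_mul (rp x) (rp y)).
Let oppQ (x : Q) : Q := cl (lfrac_opp (rp x)).

(* lfrac_sends p x y means that x * p = y in the ring of fractions. *)
Let sendsf (p : lfrac) (x y : R) : Prop := exists u a,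
  [/\ S u, u * x = a * lden p & u * y = a * lnum p].
Definition lfrac_sends (q : Q) (x y : R) : Prop := sendsf (rp q) x y.
Local Notation sends := lfrac_sends.

Lemma lfrac_sends_cl p x y : sends (cl p) x y <-> sendsf p x y.
Proof.
suff T f g : lfrac_eqP f g -> sendsf f x y -> sendsf g x y.
  have E : cl (rp (cl p)) = cl p by exact: lfrac_rpK.
  split; apply: T; [exact/lfrac_clP | by apply/lfrac_clP; rewrite E].
move=> [c [e [Sc Ed En]]] [u [a [Su Ex Ey]]].
have [k [h [Sk]]] := ore (a * lden f) Sc.
rewrite !mulrA => /(rS (ldenP f)) E.
exists (k * u), (h * e); rewrite -!mulrA Ex Ey -Ed -En !mulrA E.
by split=> //; exact: SM.
Qed.

Lemma lfrac_sends_eq p q u y : S u -> sends p u y -> sends q u y -> p = q.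
Proof.
move=> Su [v [a [Sv E1 E2]]] [w [b [Sw E3 E4]]].
rewrite -(lfrac_rpK p) -(lfrac_rpK q); apply/lfrac_clP.
have [c [d [Sc E]]] := ore v Sw.
exists (c * a), (d * b); rewrite -!mulrA -E1 -E2 -E3 -E4 !mulrA E.
by split=> //; rewrite -E; apply: SM => //; exact: SM.
Qed.

Lemma lfrac_sendsZ p a x y : sends p x y -> sends p (a * x) (a * y).
Proof.
move=> [u [b [Su E1 E2]]]; have [k [c [Sk E]]] := ore a Su.
by exists k, (c * b); rewrite !mulrA E -!mulrA E1 E2.
Qed.

Lemma lfrac_sendsD p q x y z :
  sends p x y -> sends q x z -> sends (addQ p q) x (y + z).
Proof.
move=> [v [a [Sv E1 E2]]] [w [b [Sw E3 E4]]]; apply/lfrac_sends_cl.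
rewrite /lfrac_add; case: cid => -[e f] /= [Se Ef].
have [c [d [Sc E]]] := ore v Sw.
have [k [g [Sk]]] := ore (c * v * x) Se.
have F1 : c * v * x = c * a * lden (rp p) by rewrite -!mulrA E1.
have F2 : c * v * x = d * b * lden (rp q) by rewrite E -!mulrA E3.
move=> G.
have G1 : k * (c * a) = g * e.
  by apply: (rS (ldenP (rp p))); rewrite -!mulrA -G F1 !mulrA.
have G2 : k * (d * b) = g * f.
  by apply: (rS (ldenP (rp q))); rewrite -[RHS]mulrA -Ef -G F2 !mulrA.
exists (k * (c * v)), g; split; first by apply: SM => //; exact: SM.
  by rewrite -mulrA G.
rewrite !mulrDr !mulrA -G1 -G2 -!mulrA -E2 -E4; congr (_ + _).
by rewrite (mulrA c) E !mulrA.
Qed.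

Lemma lfrac_sendsM p q x y z :
  sends p x y -> sends q y z -> sends (mulQ p q) x z.
Proof.
move=> [v [a [Sv E1 E2]]] [w [b [Sw E3 E4]]]; apply/lfrac_sends_cl.
rewrite /lfrac_mul; case: cid => -[u e] /= [Su Eu].
have [c [d [Sc E]]] := ore v Sw.
have [k [g [Sk G]]] := ore (c * a) Su.
have G2 : k * (d * b) = g * e.
  apply: (rS (ldenP (rp q))); rewrite -[RHS]mulrA -Eu (mulrA g) -G.
  by rewrite -!mulrA -E2 -E3 (mulrA d) -E !mulrA.
exists (k * (c * v)), g; split; first by apply: SM => //; exact: SM.
  by rewrite -!mulrA E1 !mulrA -G !mulrA.
by rewrite E -!mulrA E4 [RHS]mulrA -G2 !mulrA.
Qed.

Lemma lfrac_sendsN p x y : sends p x y -> sends (oppQ p) x (- y).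
Proof.
move=> [u [a [Su E1 E2]]]; apply/lfrac_sends_cl; exists u, a => /=.
by rewrite !mulrN E2.
Qed.

Lemma lfrac_sends_in r x : sends (lfrac_in r) x (x * r).
Proof. by apply/lfrac_sends_cl; exists 1, x; rewrite /= !mul1r mulr1. Qed.

Lemma lfrac_sends_in' r x y : x * r = y -> sends (lfrac_in r) x y.
Proof. by move=> <-; exact: lfrac_sends_in. Qed.

Lemma lfrac_sends_tot p x : exists u y, S u /\ sends p (u * x) y.
Proof.
have [u [a [Su E]]] := ore x (ldenP (rp p)).
exists u, (a * lnum (rp p)); split=> //.
by exists 1, a; rewrite !mul1r.
Qed.

(* Three fractions have a common denominator. *)
Lemma lfrac_sends3 p q r : exists u x y z,
  [/\ S u, sends p u x, sends q u y & sends r u z].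
Proof.
have [u1 [x [Su1 E1]]] := lfrac_sends_tot p 1.
have [u2 [y [Su2 E2]]] := lfrac_sends_tot q u1.
have [u3 [z [Su3 E3]]] := lfrac_sends_tot r (u2 * u1).
rewrite mulr1 in E1.
exists (u3 * (u2 * u1)), (u3 * (u2 * x)), (u3 * y), z; split=> //.
- by apply: SM => //; exact: SM.
- by do 2![apply: lfrac_sendsZ].
- exact: lfrac_sendsZ.
Qed.

Let addQA : associative addQ.
Proof.
move=> p q r; have [u [x [y [z [Su Hp Hq Hr]]]]] := lfrac_sends3 p q r.
apply: (@lfrac_sends_eq _ _ u (x + y + z)) => //.
  by rewrite -addrA; do 2![apply: lfrac_sendsD => //].
by do 2![apply: lfrac_sendsD => //].
Qed.

Let addQC : commutative addQ.
Proof.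
move=> p q; have [u [x [y [_ [Su Hp Hq _]]]]] := lfrac_sends3 p q p.
apply: (@lfrac_sends_eq _ _ u (x + y)) => //; first exact: lfrac_sendsD.
by rewrite addrC; exact: lfrac_sendsD.
Qed.

Let add0Q : left_id (lfrac_in 0) addQ.
Proof.
move=> p; have [u [x [_ [_ [Su Hp _ _]]]]] := lfrac_sends3 p p p.
apply: (@lfrac_sends_eq _ _ u x) => //; rewrite -[x]add0r.
by apply: lfrac_sendsD => //; apply: lfrac_sends_in'; rewrite mulr0.
Qed.

Let addNQ : left_inverse (lfrac_in 0) oppQ addQ.
Proof.
move=> p; have [u [x [_ [_ [Su Hp _ _]]]]] := lfrac_sends3 p p p.
apply: (@lfrac_sends_eq _ _ u 0) => //.
  by rewrite -(addNr x); apply: lfrac_sendsD => //; exact: lfrac_sendsN.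
by apply: lfrac_sends_in'; rewrite mulr0.
Qed.

HB.instance Definition _ := GRing.isZmodule.Build Q addQA addQC add0Q addNQ.

Let mulQA : associative mulQ.
Proof.
move=> p q r.
have [u [x [Su Hp]]] := lfrac_sends_tot p 1; rewrite mulr1 in Hp.
have [v [y [Sv Hq]]] := lfrac_sends_tot q x.
have [w [z [Sw Hr]]] := lfrac_sends_tot r y.
have {}Hq := lfrac_sendsZ w Hq.
have {}Hp := lfrac_sendsZ w (lfrac_sendsZ v Hp).
apply: (@lfrac_sends_eq _ _ (w * (v * u)) z).
- by apply: SM => //; exact: SM.
- exact: lfrac_sendsM Hp (lfrac_sendsM Hq Hr).
- exact: lfrac_sendsM (lfrac_sendsM Hp Hq) Hr.
Qed.

Let mul1Q : left_id (lfrac_in 1) mulQ.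
Proof.
move=> p; have [u [x [_ [_ [Su Hp _ _]]]]] := lfrac_sends3 p p p.
apply: (@lfrac_sends_eq _ _ u x) => //; apply: lfrac_sendsM Hp.
by apply: lfrac_sends_in'; rewrite mulr1.
Qed.

Let mulQ1 : right_id (lfrac_in 1) mulQ.
Proof.
move=> p; have [u [x [_ [_ [Su Hp _ _]]]]] := lfrac_sends3 p p p.
apply: (@lfrac_sends_eq _ _ u x) => //; apply: lfrac_sendsM Hp _.
by apply: lfrac_sends_in'; rewrite mulr1.
Qed.

Let mulQDl : left_distributive mulQ +%R.
Proof.
move=> p q r; have [u [x [y [_ [Su Hp Hq _]]]]] := lfrac_sends3 p q p.
have [v [z [Sv Hr]]] := lfrac_sends_tot r x.
have [w [t [Sw Hr']]] := lfrac_sends_tot r (v * y).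
have {}Hr := lfrac_sendsZ w Hr.
have {}Hp := lfrac_sendsZ w (lfrac_sendsZ v Hp).
have {}Hq := lfrac_sendsZ w (lfrac_sendsZ v Hq).
apply: (@lfrac_sends_eq _ _ (w * (v * u)) (w * z + t)).
- by apply: SM => //; exact: SM.
- apply: lfrac_sendsM (lfrac_sendsD Hp Hq) _.
  move: Hr Hr' => [k [a [Sk E1 E2]]] [l [b [Sl E3 E4]]].
  have [c [d [Sc E]]] := ore k Sl.
  exists (c * k), (c * a + d * b); split; first exact: SM.
    rewrite mulrDr mulrDl; congr (_ + _); first by rewrite -!mulrA E1.
    by rewrite E -!mulrA E3.
  rewrite mulrDr mulrDl; congr (_ + _); first by rewrite -!mulrA E2.
  by rewrite E -!mulrA E4.
- by apply: lfrac_sendsD; [exact: lfrac_sendsM Hp Hr | exact: lfrac_sendsM Hq Hr'].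
Qed.

Let mulQDr : right_distributive mulQ +%R.
Proof.
move=> p q r.
have [u [x [Su Hp]]] := lfrac_sends_tot p 1; rewrite mulr1 in Hp.
have [v [y [Sv Hq]]] := lfrac_sends_tot q x.
have [w [z [Sw Hr]]] := lfrac_sends_tot r (v * x).
have {}Hq := lfrac_sendsZ w Hq.
have {}Hp := lfrac_sendsZ w (lfrac_sendsZ v Hp).
apply: (@lfrac_sends_eq _ _ (w * (v * u)) (w * y + z)).
- by apply: SM => //; exact: SM.
- exact: lfrac_sendsM Hp (lfrac_sendsD Hq Hr).
- by apply: lfrac_sendsD; [exact: lfrac_sendsM Hp Hq | exact: lfrac_sendsM Hp Hr].
Qed.

Lemma lfrac_in_inj : injective lfrac_in.
Proof.
move=> r r' /lfrac_clP[a [b [/= Sa]]]; rewrite !mulr1 in Sa *.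
by move=> <-; exact: (HS.2 _ Sa).1.
Qed.

Let oneQ_neq0 : lfrac_in 1 != 0 :> Q.
Proof. by apply/eqP => /lfrac_in_inj /eqP; rewrite oner_eq0. Qed.

HB.instance Definition _ := GRing.Zmodule_isNzRing.Build Q
  mulQA mul1Q mulQ1 mulQDl mulQDr oneQ_neq0.

Let lfrac_in_additive : {morph lfrac_in : x y / x - y}.
Proof.
move=> x y; apply: (@lfrac_sends_eq _ _ 1 (x - y)) => //.
  by apply: lfrac_sends_in'; rewrite mul1r.
apply: lfrac_sendsD; first by apply: lfrac_sends_in'; rewrite mul1r.
by apply: lfrac_sendsN; apply: lfrac_sends_in'; rewrite mul1r.
Qed.

Let lfrac_in_multiplicative : monoid_morphism lfrac_in.
Proof.
split=> // x y; apply: (@lfrac_sends_eq _ _ 1 (x * y)) => //.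
  by apply: lfrac_sends_in'; rewrite mul1r.
by apply: (@lfrac_sendsM _ _ _ x); apply: lfrac_sends_in'; rewrite ?mul1r.
Qed.

HB.instance Definition _ :=
  GRing.isZmodMorphism.Build R Q lfrac_in lfrac_in_additive.
HB.instance Definition _ :=
  GRing.isMonoidMorphism.Build R Q lfrac_in lfrac_in_multiplicative.

Lemma lfrac_in_unit s : S s ->
  exists v : Q, v * lfrac_in s = 1 /\ lfrac_in s * v = 1.
Proof.
move=> Ss; exists (cl (LFrac 1 Ss)).
have H x : sends (cl (LFrac 1 Ss)) (x * s) x.
  by apply/lfrac_sends_cl; exists 1, x; rewrite /= !mul1r mulr1.
split; [apply: (@lfrac_sends_eq _ _ s s) | apply: (@lfrac_sends_eq _ _ 1 1)] => //.
- apply: (@lfrac_sendsM _ _ _ 1); first by rewrite -{2}(mul1r s); exact: H.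
  by apply: lfrac_sends_in'; rewrite mul1r.
- by apply: lfrac_sends_in'; rewrite mulr1.
- apply: (@lfrac_sendsM _ _ _ (1 * s)); last exact: H.
  exact: lfrac_sends_in.
- by apply: lfrac_sends_in'; rewrite mulr1.
Qed.

Lemma lfrac_surj (q : Q) : exists s r, S s /\ lfrac_in s * q = lfrac_in r.
Proof.
exists (lden (rp q)), (lnum (rp q)); split; first exact: ldenP.
apply: (@lfrac_sends_eq _ _ 1 (lnum (rp q))) => //; last first.
  by apply: lfrac_sends_in'; rewrite mul1r.
apply: (@lfrac_sendsM _ _ _ (lden (rp q))).
  by apply: lfrac_sends_in'; rewrite mul1r.
by exists 1, 1; rewrite !mul1r.
Qed.

End LeftFractions.

Definition is_left_quotient_ring (R : nzRingType) (S : set R) (Q : nzRingType)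
    (iota : {rmorphism R -> Q}) : Prop :=
  [/\ injective iota,
      forall s, S s -> exists v, v * iota s = 1 /\ iota s * v = 1
    & forall q, exists s r, S s /\ iota s * q = iota r].

Definition is_right_quotient_ring (R : nzRingType) (S : set R) (Q : nzRingType)
    (iota : {rmorphism R -> Q}) : Prop :=
  [/\ injective iota,
      forall s, S s -> exists v, v * iota s = 1 /\ iota s * v = 1
    & forall q, exists s r, S s /\ q * iota s = iota r].

Definition Ql (R : nzRingType) : nzRingType := lfrac_ring (Sl_Ore R).

(* R S_r(R)^-1, obtained as the opposite ring of S_l(R^op)^-1 R^op; recall that
   S_r(R) and S_l(R^op) are the same set (SrE). *)
Definition Qr (R : nzRingType) : nzRingType := (Ql R^c)^c.

Lemma QlP (R : nzRingType) :
  exists iota : {rmorphism R -> Ql R}, is_left_quotient_ring (Sl R) iota.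
Proof.
exists (lfrac_in (Sl_Ore R)); split.
- exact: lfrac_in_inj.
- exact: lfrac_in_unit.
- exact: lfrac_surj.
Qed.

Lemma QrP (R : nzRingType) :
  exists iota : {rmorphism R -> Qr R}, is_right_quotient_ring (Sr R) iota.
Proof.
have [iota [inj unit surj]] := QlP R^c.
pose f : R -> Qr R := iota.
have fB : {morph f : x y / x - y} by exact: (rmorphB iota).
have fM : monoid_morphism f.
  by split=> [|x y]; [exact: (rmorph1 iota) | exact: (rmorphM iota y x)].
pose mB := GRing.isZmodMorphism.Build R (Qr R) f fB.
pose mM := GRing.isMonoidMorphism.Build R (Qr R) f fM.
pose F : {rmorphism R -> Qr R} := HB.pack f mB mM.
exists F; split=> //.
- by move=> s; rewrite SrE => /unit[v [? ?]]; exists v.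
- by move=> q; have [s [r H]] := surj q; exists s, r; rewrite SrE.
Qed.

Section WeakDimension.
Variable R : pzRingType.

(* A right R-module is a left module over the converse ring R^c, so that
   [r *: a] stands for a r.  The tensor product of a right module A and a left
   module M over R is presented by generators and relations: an element is a
   formal sum (a list) of pure tensors, and tensor_eq is equality in it.
   Negatives come for free, since (- a) (x) m is inverse to a (x) m. *)
Inductive tensor_eq (A : lmodType R^c) (M : lmodType R) :
    seq (A * M) -> seq (A * M) -> Prop :=
| tensor_refl s : tensor_eq s s
| tensor_sym s t : tensor_eq s t -> tensor_eq t s
| tensor_trans s t u : tensor_eq s t -> tensor_eq t u -> tensor_eq s u
| tensor_cat s s' t t' : tensor_eq s s' -> tensor_eq t t' ->
    tensor_eq (s ++ t) (s' ++ t')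
| tensor_catC s t : tensor_eq (s ++ t) (t ++ s)
| tensor_0l m : tensor_eq [:: (0, m)] [::]
| tensor_Dl a b m : tensor_eq [:: (a + b, m)] [:: (a, m); (b, m)]
| tensor_Dr a m n : tensor_eq [:: (a, m + n)] [:: (a, m); (a, n)]
| tensor_balanced a (r : R) m :
    tensor_eq [:: ((r : R^c) *: a, m)] [:: (a, r *: m)].

Definition tensor_map (A B : lmodType R^c) (M : lmodType R) (f : A -> B)
  (s : seq (A * M)) : seq (B * M) := [seq (f am.1, am.2) | am <- s].

Definition flat (M : lmodType R) : Prop :=
  forall (A B : lmodType R^c) (f : {linear A -> B}), injective f ->
  forall s t : seq (A * M),
    tensor_eq (tensor_map f s) (tensor_map f t) -> tensor_eq s t.

(* M has a flat resolution 0 -> F_n -> ... -> F_1 -> F_0 -> M -> 0. *)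
Definition flat_dim_le (M : lmodType R) (n : nat) : Prop :=
  exists (F : nat -> lmodType R) (d : forall i, {linear F i.+1 -> F i})
         (e : {linear F 0%N -> M}),
    [/\ forall i, flat (F i),
        forall i, (n < i)%N -> forall x : F i, x = 0,
        forall m, exists x, e x = m,
        forall x, e x = 0 <-> exists y, d 0%N y = x
      & forall i x, d i x = 0 <-> exists y, d i.+1 y = x].

Definition weak_dim_le (n : nat) : Prop :=
  forall M : lmodType R, flat_dim_le M n.

(* w.dim R = n: n is the supremum of the flat dimensions of the left
   R-modules. *)
Definition weak_dim_is (n : nat) : Prop :=
  weak_dim_le n /\ forall m, weak_dim_le m -> (n <= m)%N.

End WeakDimension.

Section IntegroDifferential.
Variable K : fieldType.

Definition poly_end : Type := {linear {poly K} -> {poly K}}.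
HB.instance Definition _ := gen_eqMixin poly_end.
HB.instance Definition _ := gen_choiceMixin poly_end.

Definition end_app (f : poly_end) : {poly K} -> {poly K} :=
  (f : {linear {poly K} -> {poly K}}).

Lemma poly_endP (f g : poly_end) : (forall p, end_app f p = end_app g p) -> f = g.
Proof.
case: f g => f [[Df] [Zf]] [g [[Dg] [Zg]]]; rewrite /end_app /= => /funext E.
move: Df Zf Dg Zg; rewrite {}E => Df Zf Dg Zg.
by rewrite (Prop_irrelevance Df Dg) (Prop_irrelevance Zf Zg).
Qed.

Let end_zero : poly_end := (\0 : {linear {poly K} -> {poly K}}).
Let end_add (f g : poly_end) : poly_end :=
  (end_app f \+ end_app g : {linear {poly K} -> {poly K}}).
Let end_opp (f : poly_end) : poly_end :=
  (\- end_app f : {linear {poly K} -> {poly K}}).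
Let end_one : poly_end := (idfun : {linear {poly K} -> {poly K}}).
Let end_mul (f g : poly_end) : poly_end :=
  (end_app f \o end_app g : {linear {poly K} -> {poly K}}).
Let end_scale (a : K) (f : poly_end) : poly_end :=
  (a \*: end_app f : {linear {poly K} -> {poly K}}).

Let end_addA : associative end_add.
Proof. by move=> f g h; apply: poly_endP => p; exact: addrA. Qed.
Let end_addC : commutative end_add.
Proof. by move=> f g; apply: poly_endP => p; exact: addrC. Qed.
Let end_add0 : left_id end_zero end_add.
Proof. by move=> f; apply: poly_endP => p; exact: add0r. Qed.
Let end_addN : left_inverse end_zero end_opp end_add.
Proof. by move=> f; apply: poly_endP => p; exact: addNr. Qed.

HB.instance Definition _ :=
  GRing.isZmodule.Build poly_end end_addA end_addC end_add0 end_addN.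

Let end_mulA : associative end_mul.
Proof. by move=> f g h; apply: poly_endP. Qed.
Let end_mul1 : left_id end_one end_mul.
Proof. by move=> f; apply: poly_endP. Qed.
Let end_mulr1 : right_id end_one end_mul.
Proof. by move=> f; apply: poly_endP. Qed.
Let end_mulDl : left_distributive end_mul +%R.
Proof. by move=> f g h; apply: poly_endP. Qed.
Let end_mulDr : right_distributive end_mul +%R.
Proof. by move=> f g h; apply: poly_endP => p; exact: (linearD f). Qed.
Let end_one_neq0 : end_one != 0.
Proof.
apply/eqP => /(congr1 (fun f => end_app f 1)) /eqP; apply/negP.
exact: oner_neq0.
Qed.

HB.instance Definition _ := GRing.Zmodule_isNzRing.Build poly_end
  end_mulA end_mul1 end_mulr1 end_mulDl end_mulDr end_one_neq0.

Let end_scaleA a b (f : poly_end) :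
  end_scale a (end_scale b f) = end_scale (a * b) f.
Proof. by apply: poly_endP => p; exact: scalerA. Qed.
Let end_scale1 : left_id 1 end_scale.
Proof. by move=> f; apply: poly_endP => p; exact: scale1r. Qed.
Let end_scaleDr : right_distributive end_scale +%R.
Proof. by move=> a f g; apply: poly_endP => p; exact: scalerDr. Qed.
Let end_scaleDl (f : poly_end) : {morph end_scale^~ f : a b / a + b}.
Proof. by move=> a b; apply: poly_endP => p; exact: scalerDl. Qed.

HB.instance Definition _ := GRing.Zmodule_isLmodule.Build K poly_end
  end_scaleA end_scale1 end_scaleDr end_scaleDl.

Let end_scaleAl (a : K) (f g : poly_end) : a *: (f * g) = (a *: f) * g.
Proof. by apply: poly_endP. Qed.
HB.instance Definition _ := GRing.Lmodule_isLalgebra.Build K poly_end end_scaleAl.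

Let end_scaleAr (a : K) (f g : poly_end) : a *: (f * g) = f * (a *: g).
Proof. by apply: poly_endP => p; rewrite /end_app /= linearZ. Qed.
HB.instance Definition _ := GRing.Lalgebra_isAlgebra.Build K poly_end end_scaleAr.

Lemma end_mulE (f g : poly_end) p : end_app (f * g) p = end_app f (end_app g p).
Proof. by []. Qed.
Lemma end_addE (f g : poly_end) p : end_app (f + g) p = end_app f p + end_app g p.
Proof. by []. Qed.
Lemma end_scaleE a (f : poly_end) p : end_app (a *: f) p = a *: end_app f p.
Proof. by []. Qed.

Definition poly_int (p : {poly K}) : {poly K} :=
  \sum_(m < size p) (p`_m / m.+1%:R) *: 'X^(m.+1).

Lemma coef_poly_int p i :
  (poly_int p)`_i = if i is m.+1 then p`_m / m.+1%:R else 0.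
Proof.
rewrite /poly_int coef_sum; case: i => [|m].
  by rewrite big1 // => j _; rewrite coefZ coefXn mulr0.
under eq_bigr do rewrite coefZ coefXn eqSS.
case: (ltnP m (size p)) => [lt_m|le_m].
  rewrite (bigD1 (Ordinal lt_m)) //= eqxx mulr1 big1 ?addr0 // => j.
  by rewrite -val_eqE /= eq_sym => /negbTE ->; rewrite mulr0.
rewrite nth_default // mul0r big1 // => j _.
by rewrite gtn_eqF ?mulr0 // (leq_trans (ltn_ord j)).
Qed.

Fact poly_int_linear : linear poly_int.
Proof.
move=> a p q; apply/polyP => -[|m]; rewrite coefD coefZ !coef_poly_int.
  by rewrite mulr0 addr0.
by rewrite coefD coefZ mulrDl mulrA.
Qed.
HB.instance Definition _ :=
  GRing.isLinear.Build K {poly K} {poly K} _ poly_int poly_int_linear.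

Lemma poly_int_Xn m : poly_int 'X^m = m.+1%:R^-1 *: 'X^(m.+1).
Proof.
apply/polyP => -[|i]; rewrite coef_poly_int coefZ !coefXn ?mulr0 //.
by rewrite eqSS mulrC; case: eqP => [->|]; rewrite ?mulr0.
Qed.

Fact poly_mulX_linear : linear (fun p : {poly K} => 'X * p).
Proof. by move=> a p q; rewrite mulrDr scalerAr. Qed.
Definition poly_mulX (p : {poly K}) : {poly K} := 'X * p.
HB.instance Definition _ :=
  GRing.isLinear.Build K {poly K} {poly K} _ poly_mulX poly_mulX_linear.

Definition end_x : poly_end := (poly_mulX : {linear {poly K} -> {poly K}}).
Definition end_d : poly_end := (deriv : {linear {poly K} -> {poly K}}).
Definition end_int : poly_end := (poly_int : {linear {poly K} -> {poly K}}).

(* The smallest K-subalgebra of End_K(K[x]) containing x, d/dx and int. *)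
Definition I1_pred : {pred poly_end} := fun f => `[< forall A : {pred poly_end},
  subalg_closed A -> end_x \in A -> end_d \in A -> end_int \in A -> f \in A >].

Lemma I1_subalg_closed : subalg_closed I1_pred.
Proof.
split=> [|a f g /asboolP If /asboolP Ig|f g /asboolP If /asboolP Ig];
  apply/asboolP => A A_alg Ax Ad Ai; case: (A_alg) => A1 Alin AM //.
- by apply: Alin; [exact: If | exact: Ig].
- by apply: AM; [exact: If | exact: Ig].
Qed.
HB.instance Definition _ :=
  GRing.isSubalgClosed.Build K poly_end I1_pred I1_subalg_closed.

Definition I1 : Type := {f : poly_end | f \in I1_pred}.
HB.instance Definition _ := SubChoice.on I1.
HB.instance Definition _ := [SubChoice_isSubAlgebra of I1 by <:].

End IntegroDifferential.

(* Main.v *)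
Require Import Defs.
From Stdlib Require List.
From HB Require Import structures.
From mathcomp Require Import all_boot all_order all_algebra.
From mathcomp Require Import boolp classical_sets.

(** Both quotient rings are von Neumann regular, and over a von Neumann regular
    ring every module is flat.

    Flatness. A vanishing element of a tensor product [A (x) M] lifts to a
    vanishing element of [A (x) L] for some finite free module [L] over [M]:
    over a von Neumann regular ring finitely many vectors of [L] that vanish in
    [M] can be killed by an endomorphism of [L] over [M] ([vnr_kill_kernel]),
    so that all the relations used in a derivation can be realised in one free
    module.  As [A (x) L] is a power of [A], injectivity of [A -> B] passes to
    [A (x) M -> B (x) M] ([vnr_flat]).

    Regularity. Let [F] be the ideal of compact operators of [I_1], that is, of
    the finite matrices in the basis of the powers of [x]. It is von Neumann
    regular because matrix rings over a field are. Let [T] be the set of the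
    [u] whose right multiplication is a bijection of [F]. If [I_1] satisfies
    the left Ore condition modulo [F] and each [s] outside [F] has some
    [t s + g] in [T] with [g] in [F], then [T] is a left Ore set of regular
    elements, hence is inverted in [Q_l]. For [r] outside [F] and
    [u = t r + g] in [T], the element [r - r u^-1 t r = r u^-1 g] is a fraction
    of an element of [F], so it is von Neumann regular; by McCoy's lemma so is
    [r], and then every fraction ([largest_left_quotient_vnr]).

    These two conditions hold because each [r] becomes, after multiplication by
    a power of the integration and up to [F], a polynomial
    [sum_j int^j p_j(h)] in the integration and the Euler operator [h]
    ([normal_form]). Such polynomials satisfy the Ore condition by a Euclidean
    algorithm ([ipoly_Ore]). After division by a power of the integration, a
    nonzero one is triangular with diagonal [p(n)] for some polynomial
    [p <> 0]; in characteristic zero almost all the [p(n)] are nonzero, and a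
    compact correction makes the others nonzero ([compact_lift]).

    The argument uses only the relations between the derivation, the
    integration and [h] recorded in [integro_diff]. These are preserved when
    one passes to the converse ring and exchanges derivation and integration
    ([integro_diff_converse]), which gives the statement for [Q_r]. *)

Set Implicit Arguments.
Unset Strict Implicit.
Unset Printing Implicit Defensive.

Import GRing.Theory.
Local Open Scope ring_scope.

(** * Von Neumann regular rings have weak dimension zero *)

(** [x] is a von Neumann regular element: it has an inner inverse. *)
Definition vn_regular (R : pzRingType) (x : R) : Prop :=
  exists y, x * y * x = x.

Section Flatness.
Variable R : pzRingType.
Hypothesis R_vnr : forall x : R, vn_regular x.

(** A finitely generated right ideal is generated by an idempotent. *)
Lemma vnr_row_idempotent (I : finType) (d : I -> R) :
  exists g : I -> R, forall j, (\sum_i d i * g i) * d j = d j.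
Proof.
suff [g Hg] : exists g : I -> R,
    forall j, j \in enum I -> (\sum_i d i * g i) * d j = d j.
  by exists g => j; apply: Hg; rewrite mem_enum.
elim: (enum I) => [|j s [g IH]]; first by exists (fun=> 0).
set eps := \sum_i _ in IH.
have [z Hz] := R_vnr ((1 - eps) * d j).
(* The next idempotent is eps + (1 - eps) d_j z (1 - eps). *)
exists (fun i => g i - g i * d j * z * (1 - eps)
  + (if i == j then z * (1 - eps) else 0)).
have -> : \sum_i d i * (g i - g i * d j * z * (1 - eps)
    + (if i == j then z * (1 - eps) else 0))
  = eps + (1 - eps) * d j * z * (1 - eps).
  under eq_bigr do rewrite mulrDr mulrBr !mulrA.
  rewrite big_split sumrB /= -!mulr_suml -/eps.
  rewrite (bigD1 j) //= eqxx big1 => [|i /negbTE ->]; last by rewrite mulr0.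
  by rewrite addr0 [in RHS]mulrBl mul1r !mulrBl !mulrA -addrA; congr (_ + _);
     rewrite addrC.
move=> k; rewrite inE => /orP[/eqP ->|ks].
  by rewrite mulrDl -[_ * (1 - eps) * d j]mulrA Hz mulrBl mul1r addrC subrK.
have E0 : (1 - eps) * d k = 0 by rewrite mulrBl mul1r IH ?subrr.
by rewrite mulrDl IH // -[_ * (1 - eps) * d k]mulrA E0 mulr0 addr0.
Qed.

Section Lift.
Variable M : lmodType R.

(** The linear map from the free module on [I] to [M] given by [n]. *)
Definition free_eval (I : finType) (n : I -> M) (x : I -> R) : M :=
  \sum_i x i *: n i.

(** Over a von Neumann regular ring, finitely many vectors in the kernel of a
    linear map from a finite free module to [M] can be killed by an endomorphism of the
    free module (the matrix [t]) that is compatible with the map. *)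
Lemma vnr_kill_kernel (I : finType) (n : I -> M) (ds : seq (I -> R)) :
    (forall d, List.In d ds -> free_eval n d = 0) ->
  exists t : I -> I -> R,
    (forall x : I -> R,
       free_eval n (fun j => \sum_i x i * t i j) = free_eval n x) /\
    (forall d, List.In d ds -> forall j, \sum_i d i * t i j = 0).
Proof.
elim: ds => [|d ds IH] Hds.
  exists (fun i j => (i == j)%:R); split=> // x; apply: eq_bigr => j _.
  rewrite (bigD1 j) //= eqxx mulr1 big1 ?addr0 // => i /negbTE ->.
  by rewrite mulr0.
have [|t [Ht Kt]] := IH; first by move=> c Hc; apply: Hds; right.
pose c j := \sum_i d i * t i j.
have c0 : free_eval n c = 0 by rewrite /c Ht; apply: Hds; left.
have [g Hg] := vnr_row_idempotent c.
have mulE x j : \sum_i x i * (t i j - (\sum_k t i k * g k) * c j)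
    = (\sum_i x i * t i j) - (\sum_k (\sum_i x i * t i k) * g k) * c j.
  under eq_bigr do rewrite mulrBr mulrA.
  rewrite sumrB -mulr_suml; congr (_ - _ * _).
  under eq_bigr do rewrite mulr_sumr; rewrite exchange_big /=.
  by apply: eq_bigr => k _; rewrite mulr_suml; under eq_bigr do rewrite mulrA.
exists (fun i j => t i j - (\sum_k t i k * g k) * c j); split.
  move=> x; rewrite -(Ht x) /free_eval.
  under eq_bigr do rewrite mulE scalerBl -scalerA.
  by rewrite sumrB -scaler_sumr -/(free_eval n c) c0 scaler0 subr0.
move=> f [<-|Hf] j; rewrite mulE; first by rewrite -/(c j) Hg subrr.
rewrite Kt // sub0r big1 ?mul0r ?oppr0 // => k _.
by rewrite Kt // mul0r.
Qed.

Section Equiv.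
Variable A : lmodType R^c.

(** [lifts n s l]: the list [l] of pairs in [A * R^I] lifts the formal sum [s]
    of pure tensors along the map given by [n]. *)
Definition lifts (I : finType) (n : I -> M) (s : seq (A * M))
  (l : seq (A * (I -> R))) : Prop :=
  s = [seq (p.1, free_eval n p.2) | p <- l].

(** The image of [l] in [A (x) R^I = A^I]. *)
Definition lift_val (I : finType) (l : seq (A * (I -> R))) (i : I) : A :=
  \sum_(p <- l) (p.2 i : R^c) *: p.1.

(** Two formal sums are identified when they lift to some finite free module,
    with the same image there. *)
Definition lift_eq (s t : seq (A * M)) : Prop :=
  exists (I : finType) (n : I -> M) (k l : seq (A * (I -> R))),
    [/\ lifts n s k, lifts n t l & forall i, lift_val k i = lift_val l i].

(** The two inclusions of free modules into their direct sum, and the linear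
    map on the direct sum given by its restrictions to the summands. *)
Definition ext_l (I J : finType) (x : I -> R) (u : I + J) : R :=
  if u is inl i then x i else 0.
Definition ext_r (I J : finType) (x : J -> R) (u : I + J) : R :=
  if u is inr j then x j else 0.
Definition sum_fun (I J : finType) (n : I -> M) (n' : J -> M) (u : I + J) : M :=
  match u with inl i => n i | inr j => n' j end.

Lemma free_eval_extl (I J : finType) (n : I -> M) (n' : J -> M) x :
  free_eval (sum_fun n n') (@ext_l I J x) = free_eval n x.
Proof.
rewrite /free_eval big_sumType /= [X in _ + X]big1 ?addr0 // => j _.
by rewrite scale0r.
Qed.

Lemma free_eval_extr (I J : finType) (n : I -> M) (n' : J -> M) x :
  free_eval (sum_fun n n') (@ext_r I J x) = free_eval n' x.
Proof.
rewrite /free_eval big_sumType /= [X in X + _]big1 ?add0r // => j _.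
by rewrite scale0r.
Qed.

(** Apply [h] to the coefficient vectors of a lift. *)
Definition map_lift (I J : finType) (h : (I -> R) -> J -> R)
  (l : seq (A * (I -> R))) := [seq (p.1, h p.2) | p <- l].

Lemma lifts_map (I J : finType) (n : I -> M) (n' : J -> M) h s l :
    (forall x, free_eval n' (h x) = free_eval n x) ->
  lifts n s l -> lifts n' s (map_lift h l).
Proof.
move=> Hh ->; rewrite /lifts /map_lift -map_comp.
by apply: eq_map => p /=; rewrite Hh.
Qed.

Lemma lift_val_ext_l (I J : finType) (l : seq (A * (I -> R))) (u : I + J) :
  lift_val (map_lift (@ext_l I J) l) u = if u is inl i then lift_val l i else 0.
Proof.
rewrite /lift_val big_map; case: u => //= j.
by rewrite big1 // => p _; rewrite scale0r.
Qed.

Lemma lift_val_ext_r (I J : finType) (l : seq (A * (J -> R))) (u : I + J) :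
  lift_val (map_lift (@ext_r I J) l) u = if u is inr j then lift_val l j else 0.
Proof.
rewrite /lift_val big_map; case: u => //= j.
by rewrite big1 // => p _; rewrite scale0r.
Qed.

Lemma lift_val_mul (I J : finType) (t : I -> J -> R)
    (l : seq (A * (I -> R))) j :
  lift_val (map_lift (fun x j => \sum_i x i * t i j) l) j
  = \sum_i (t i j : R^c) *: lift_val l i.
Proof.
rewrite /lift_val big_map /=.
under [RHS]eq_bigr do rewrite scaler_sumr.
rewrite exchange_big /=; apply: eq_bigr => p _; rewrite scaler_suml.
by apply: eq_bigr => i _; rewrite scalerA.
Qed.

Lemma lift_val_cat (I : finType) (k l : seq (A * (I -> R))) i :
  lift_val (k ++ l) i = lift_val k i + lift_val l i.
Proof. by rewrite /lift_val big_cat. Qed.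

Lemma lifts_cat (I : finType) (n : I -> M) s t k l :
  lifts n s k -> lifts n t l -> lifts n (s ++ t) (k ++ l).
Proof. by move=> -> ->; rewrite /lifts map_cat. Qed.

Lemma lifts_exists (s : seq (A * M)) :
  exists (I : finType) (n : I -> M) (l : seq (A * (I -> R))), lifts n s l.
Proof.
elim: s => [|[a m] s [I [n [l Hl]]]].
  by exists unit, (fun=> 0), [::].
exists (unit + I)%type, (sum_fun (fun=> m) n),
  ([:: (a, @ext_l unit I (fun=> 1))] ++ map_lift (@ext_r unit I) l).
have -> : (a, m) :: s = [:: (a, m)] ++ s by [].
apply: lifts_cat; last by apply: lifts_map Hl => x; exact: free_eval_extr.
rewrite /lifts /= free_eval_extl /free_eval.
by rewrite (bigD1 tt) //= scale1r big1 ?addr0 // => -[].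
Qed.

Lemma lift_eq_refl s : lift_eq s s.
Proof. by have [I [n [l Hl]]] := lifts_exists s; exists I, n, l, l. Qed.

Lemma lift_eq_sym s t : lift_eq s t -> lift_eq t s.
Proof. by move=> [I [n [k [l [? ? E]]]]]; exists I, n, l, k; split. Qed.

(** Two lifts of the same formal sum differ by vectors of the kernel. *)
Lemma lifts_kernel (I : finType) (n : I -> M) s (k l : seq (A * (I -> R))) :
    lifts n s k -> lifts n s l ->
  exists ds : seq (I -> R), (forall d, List.In d ds -> free_eval n d = 0) /\
    forall t : I -> I -> R,
    (forall d, List.In d ds -> forall j, \sum_i d i * t i j = 0) ->
    forall j, lift_val (map_lift (fun x j => \sum_i x i * t i j) k) j
            = lift_val (map_lift (fun x j => \sum_i x i * t i j) l) j.
Proof.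
elim: s k l => [|[a m] s IH] [|[a1 x] k] [|[a2 y] l] //=.
  by move=> _ _; exists [::].
move=> [<- Ex Hk] [<- Ey Hl]; have [ds [Hds Eds]] := IH k l Hk Hl.
exists ((fun i => x i - y i) :: ds); split.
  move=> d [<-|]; last exact: Hds.
  rewrite /free_eval; under eq_bigr do rewrite scalerBl.
  by rewrite sumrB -!/(free_eval _ _) -Ex -Ey subrr.
move=> t Ht j; rewrite /lift_val /= !big_cons /=.
rewrite -!/(lift_val (map_lift _ _) _) Eds; last first.
  by move=> d Hd; apply: Ht; right.
congr (_ *: _ + _); apply/eqP; rewrite -subr_eq0 -sumrB; apply/eqP.
transitivity (\sum_i (x i - y i) * t i j).
  by apply: eq_bigr => i _; rewrite mulrBl.
by rewrite (Ht (fun i => x i - y i)) //; left.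
Qed.

Lemma lift_eq_trans s t u : lift_eq s t -> lift_eq t u -> lift_eq s u.
Proof.
move=> [I [n [k [l [Hk Hl E]]]]] [J [n' [k' [l' [Hk' Hl' E']]]]].
pose N := sum_fun n n'.
have HL := lifts_map (n' := N) (@free_eval_extl I J n n').
have HR := lifts_map (n' := N) (@free_eval_extr I J n n').
have [ds [Hds Eds]] := lifts_kernel (HL _ _ Hl) (HR _ _ Hk').
have [th [Hth Kth]] := vnr_kill_kernel Hds.
exists (I + J)%type, N, (map_lift (fun x j => \sum_i x i * th i j)
    (map_lift (@ext_l I J) k)),
  (map_lift (fun x j => \sum_i x i * th i j) (map_lift (@ext_r I J) l')).
split; [exact: lifts_map Hth (HL _ _ Hk)|exact: lifts_map Hth (HR _ _ Hl')|].
move=> j; transitivity (lift_val (map_lift (fun x j => \sum_i x i * th i j)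
    (map_lift (@ext_l I J) l)) j).
  rewrite !lift_val_mul; apply: eq_bigr => i _; rewrite !lift_val_ext_l.
  by case: i => // i; rewrite E.
rewrite Eds // !lift_val_mul; apply: eq_bigr => i _; rewrite !lift_val_ext_r.
by case: i => // i; rewrite E'.
Qed.

Lemma lift_eq_cat s s' t t' :
  lift_eq s s' -> lift_eq t t' -> lift_eq (s ++ t) (s' ++ t').
Proof.
move=> [I [n [k [l [Hk Hl E]]]]] [J [n' [k' [l' [Hk' Hl' E']]]]].
have HL := lifts_map (n' := sum_fun n n') (@free_eval_extl I J n n').
have HR := lifts_map (n' := sum_fun n n') (@free_eval_extr I J n n').
exists (I + J)%type, (sum_fun n n'),
  (map_lift (@ext_l I J) k ++ map_lift (@ext_r I J) k'),
  (map_lift (@ext_l I J) l ++ map_lift (@ext_r I J) l'); split.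
- by apply: lifts_cat; [exact: HL|exact: HR].
- by apply: lifts_cat; [exact: HL|exact: HR].
- move=> i; rewrite !lift_val_cat !lift_val_ext_l !lift_val_ext_r.
  by case: i => i; rewrite ?E ?E'.
Qed.

Lemma lift_eq_catC s t : lift_eq (s ++ t) (t ++ s).
Proof.
have [I [n [k Hk]]] := lifts_exists s; have [J [n' [l Hl]]] := lifts_exists t.
have {}Hk := lifts_map (n' := sum_fun n n') (@free_eval_extl I J n n') Hk.
have {}Hl := lifts_map (n' := sum_fun n n') (@free_eval_extr I J n n') Hl.
exists (I + J)%type, (sum_fun n n'),
  (map_lift (@ext_l I J) k ++ map_lift (@ext_r I J) l),
  (map_lift (@ext_r I J) l ++ map_lift (@ext_l I J) k).
split; try exact: lifts_cat.
by move=> i; rewrite !lift_val_cat addrC.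
Qed.

Lemma free_eval_bool (n : bool -> M) x :
  free_eval n x = x true *: n true + x false *: n false.
Proof.
rewrite /free_eval (bigD1 true) //= (bigD1 false) //=.
by rewrite big1 ?addr0 // => -[].
Qed.

(** Each defining relation of the tensor product lifts to a free module of rank
    at most two. *)
Lemma tensor_eq_lift_eq s t : tensor_eq s t -> lift_eq s t.
Proof.
elim=> {s t}.
- exact: lift_eq_refl.
- by move=> s t _; exact: lift_eq_sym.
- by move=> s t u _ H _; exact: lift_eq_trans.
- by move=> s s' t t' _ H _; exact: lift_eq_cat.
- exact: lift_eq_catC.
- move=> m; pose x (b : bool) : R := b%:R.
  exists bool, (fun=> m), [:: (0, x)], [::]; split=> //.
    by rewrite /lifts /= free_eval_bool scale1r scale0r addr0.
  by move=> i; rewrite /lift_val big_seq1 big_nil scaler0.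
- move=> a b m; pose x (b : bool) : R := b%:R.
  exists bool, (fun=> m), [:: (a + b, x)], [:: (a, x); (b, x)].
  split; rewrite /lifts /= ?free_eval_bool ?scale1r ?scale0r ?addr0 //.
  by move=> i; rewrite /lift_val big_seq1 !big_cons big_nil addr0 scalerDr.
- move=> a m n; pose x (b : bool) : R := b%:R.
  pose y (b : bool) : R := (~~ b)%:R.
  exists bool, (fun b => if b then m else n),
    [:: (a, fun b => x b + y b)], [:: (a, x); (a, y)].
  split; rewrite /lifts /= ?free_eval_bool /x /y /=
    ?addr0 ?add0r ?scale1r ?scale0r ?addr0 ?add0r //.
  by move=> i; rewrite /lift_val big_seq1 !big_cons big_nil addr0 scalerDl.
- move=> a r m; pose x (b : bool) : R := b%:R.
  exists bool, (fun=> m), [:: ((r : R^c) *: a, x)], [:: (a, fun b => r * x b)].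
  split; rewrite /lifts /= ?free_eval_bool /x /=
    ?mulr1 ?mulr0 ?scale1r ?scale0r ?addr0 //.
  by move=> i; rewrite /lift_val !big_seq1 /= scalerA; case: i;
     rewrite ?mulr1 ?mul1r ?mulr0 ?mul0r.
Qed.

Lemma tensor_0r (a : A) : tensor_eq [:: (a, 0 : M)] [::].
Proof.
rewrite -(scale0r (0 : M)); apply: tensor_trans.
  exact/tensor_sym/tensor_balanced.
by rewrite scale0r; exact: tensor_0l.
Qed.

Lemma tensor_sum (J : Type) (r : seq J) (a : A) (x : J -> R) (n : J -> M) :
  tensor_eq [:: (a, \sum_(i <- r) x i *: n i)]
    [seq ((x i : R^c) *: a, n i) | i <- r].
Proof.
elim: r => [|i r IH]; first by rewrite big_nil; exact: tensor_0r.
rewrite big_cons /=; apply: tensor_trans; first exact: tensor_Dr.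
rewrite -[_ :: map _ _]cat1s -[[:: _; _]]cat1s; apply: tensor_cat => //.
exact/tensor_sym/tensor_balanced.
Qed.

Lemma tensor_zip (J : Type) (r : seq J) (a b : J -> A) (n : J -> M) :
  tensor_eq ([seq (a i, n i) | i <- r] ++ [seq (b i, n i) | i <- r])
    [seq (a i + b i, n i) | i <- r].
Proof.
elim: r => [|i r IH] /=; first exact: tensor_refl.
have swap (x y : A * M) S T :
    tensor_eq ((x :: S) ++ y :: T) ([:: x; y] ++ S ++ T).
  rewrite -[x :: S]cat1s -[y :: T]cat1s -[[:: x; y]]cat1s -!catA.
  apply: tensor_cat; first exact: tensor_refl.
  by rewrite !catA; apply: tensor_cat; [exact: tensor_catC|exact: tensor_refl].
apply: tensor_trans (swap _ _ _ _) _; rewrite -[X in tensor_eq _ X]cat1s.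
by apply: tensor_cat; first exact/tensor_sym/tensor_Dl.
Qed.

(** A formal sum is determined, up to equality in the tensor product, by the
    value of any of its lifts. *)
Lemma tensor_lift_val (I : finType) (n : I -> M) s l : lifts n s l ->
  tensor_eq s [seq (lift_val l i, n i) | i <- enum I].
Proof.
move=> ->; elim: l => [|[a x] l IH] /=.
  elim: (enum I) => [|i r IH] /=; first exact: tensor_refl.
  rewrite -[X in tensor_eq X](cats0 [::]) -cat1s; apply: tensor_cat => //.
  by rewrite /lift_val big_nil; exact/tensor_sym/tensor_0l.
rewrite -cat1s; apply: tensor_trans (tensor_cat (tensor_refl _) IH) _.
have -> : [seq (lift_val ((a, x) :: l) i, n i) | i <- enum I]
    = [seq ((x i : R^c) *: a + lift_val l i, n i) | i <- enum I].
  by apply: eq_map => i; rewrite /lift_val big_cons.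
apply: tensor_trans (tensor_zip _ _ _ _).
apply: tensor_cat; last exact: tensor_refl.
by rewrite /free_eval -big_enum; exact: tensor_sum.
Qed.

Lemma lift_eq_tensor_eq s t : lift_eq s t -> tensor_eq s t.
Proof.
move=> [I [n [k [l [Hk Hl E]]]]].
apply: tensor_trans (tensor_lift_val Hk) _.
apply/tensor_sym; apply: tensor_trans (tensor_lift_val Hl) _.
by under eq_map do rewrite -E; exact: tensor_refl.
Qed.

End Equiv.

Lemma vnr_flat : flat M.
Proof.
move=> A B f injf s t /tensor_eq_lift_eq [I [n [k [l [Hk Hl E]]]]].
have descend (u : seq (A * M)) (v : seq (B * (I -> R))) :
    lifts n (tensor_map f u) v ->
    exists2 w : seq (A * (I -> R)), lifts n u w
      & v = [seq (f p.1, p.2) | p <- w].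
  elim: u v => [|[a m] u IH] [|[b x] v] //=; first by exists [::].
  by move=> [<- -> Hv]; have [w -> ->] := IH v Hv; exists ((a, x) :: w).
have valE (w : seq (A * (I -> R))) i :
    lift_val [seq (f p.1, p.2) | p <- w] i = f (lift_val w i).
  rewrite /lift_val big_map linear_sum; apply: eq_bigr => p _.
  by rewrite linearZ.
have [k' Hk' Ek] := descend _ _ Hk; have [l' Hl' El] := descend _ _ Hl.
apply: lift_eq_tensor_eq; exists I, n, k', l'; split=> // i.
by apply: injf; rewrite -!valE -Ek -El E.
Qed.

End Lift.

Lemma vnr_weak_dim0 : weak_dim_is R 0.
Proof.
split=> // M.
(* The flat resolution is M in degree 0 and the zero module elsewhere. *)
pose Z : lmodType R := 'rV[R]_0.
pose F i : lmodType R := if i is 0%N then M else Z.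
exists F, (fun i => (\0 : {linear F i.+1 -> F i})),
  (idfun : {linear F 0%N -> M}); split.
- by move=> i; exact: vnr_flat.
- by case=> // i _ x; exact: thinmx0.
- by move=> m; exists m.
- by move=> x; split=> [x0|[y <-]] //; exists 0; exact: esym x0.
- move=> i x; split=> // _; exists 0.
  by rewrite [x]thinmx0.
Qed.

End Flatness.

(** * A regularity criterion for the largest left quotient ring *)

(** McCoy's lemma. *)
Lemma vn_regular_mod (R : pzRingType) (x y : R) :
  vn_regular (x - x * y * x) -> vn_regular x.
Proof.
move=> [z Hz]; exists (y + (1 - y * x) * z * (1 - x * y)).
have E1 : x * (1 - y * x) = x - x * y * x by rewrite mulrBr mulr1 mulrA.
have E2 : (1 - x * y) * x = x - x * y * x by rewrite mulrBl mul1r.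
rewrite mulrDr mulrDl !mulrA E1 -[_ * (1 - x * y) * x]mulrA E2 Hz.
by rewrite addrC subrK.
Qed.

Lemma vn_regular_unit (R : pzRingType) (x u v : R) :
  u * v = 1 -> v * u = 1 -> vn_regular (u * x) -> vn_regular x.
Proof.
move=> uv vu [y Hy]; exists (y * u).
have E : v * (u * x) = x by rewrite mulrA vu mul1r.
suff -> : x * (y * u) * x = v * (u * x * y * (u * x)) by rewrite Hy E.
by rewrite !mulrA vu mul1r.
Qed.

Section Criterion.
Variables (R : nzRingType) (F : R -> Prop).

(** Right multiplication by [u] permutes [F]. *)
Definition permutes_right (u : R) : Prop :=
  (forall f, F f -> f * u = 0 -> f = 0) /\
  (forall f, F f -> exists2 f', F f' & f' * u = f).

Hypothesis FMl : forall r f, F f -> F (r * f).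
Hypothesis FMr : forall r f, F f -> F (f * r).
Hypothesis F1 : ~ F 1.
Hypothesis F_faithful : forall r, (forall f, F f -> f * r = 0) -> r = 0.
Hypothesis F_vnr : forall f, F f -> vn_regular f.
Hypothesis F_Ore : forall r s, ~ F s ->
  exists p q, ~ F p /\ F (p * r - q * s).
Hypothesis F_lift : forall s, ~ F s ->
  exists t g, F g /\ permutes_right (t * s + g).

Lemma permutes_right_regular u : permutes_right u -> regular_elt u.
Proof.
move=> [inj surj]; split; move=> x y /eqP; rewrite -subr_eq0.
  rewrite -mulrBr => /eqP E; apply/eqP; rewrite -subr_eq0; apply/eqP.
  apply: F_faithful => f /surj[f' _ <-].
  by rewrite -mulrA E mulr0.
rewrite -mulrBl => /eqP E; apply/eqP; rewrite -subr_eq0; apply/eqP.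
apply: F_faithful => f Ff; apply: inj; first exact: FMr.
by rewrite -mulrA E mulr0.
Qed.

Lemma permutes_right_Ore : regular_left_Ore_set (permutes_right : set R).
Proof.
split; last exact: permutes_right_regular.
split; first split.
- by split=> [f _|f Ff]; [rewrite mulr1|exists f; rewrite ?mulr1].
- move=> [inj _]; have /eqP := oner_neq0 R; apply.
  by apply: F_faithful => f Ff; rewrite mulr1; apply: inj; rewrite ?mulr0.
- move=> s t [is_ ss] [it st]; split=> [f Ff|f /st[g /ss[h Fh <-] <-]].
    rewrite mulrA => E; apply: is_ => //; apply: it E; exact: FMr.
  by exists h; rewrite ?mulrA.
move=> r s Ts; have [_ ss] := Ts.
have nFs : ~ F s.
  move=> Fs; have [y Hy] := F_vnr Fs; apply: F1.
  have /permutes_right_regular[ls _] := Ts.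
  suff <- : y * s = 1 by exact: FMl.
  by apply: ls; rewrite mulrA Hy mulr1.
have [p [q [nFp Fpq]]] := F_Ore r nFs.
have [t [g [Fg Tt]]] := F_lift nFp.
have [f _ Ef] := ss _ Fpq.
have [f' _ Ef'] := ss _ (FMr r Fg).
exists (t * p + g), (t * (q + f) + f'); split=> //.
rewrite !mulrDl Ef' -!mulrA; congr (_ + _).
by rewrite mulrDl Ef addrC subrK.
Qed.

Lemma largest_left_quotient_vnr (q : Ql R) : vn_regular q.
Proof.
have [iota [_ inv frac]] := QlP R.
have iotaF f : F f -> vn_regular (iota f).
  by move=> /F_vnr[y Hy]; exists (iota y); rewrite -!rmorphM Hy.
have fracF (x : Ql R) f : F f -> vn_regular (x * iota f).
  move=> Ff; have [s [r [Ss E]]] := frac x; have [v [vs sv]] := inv s Ss.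
  apply: (vn_regular_unit sv vs); rewrite mulrA E -rmorphM.
  exact/iotaF/FMl.
have [s [r [Ss E]]] := frac q; have [v [vs sv]] := inv s Ss.
apply: (vn_regular_unit sv vs); rewrite {}E {q s v Ss vs sv}.
have [Fr|/F_lift[t [g [Fg Tu]]]] := pselect (F r); first exact: iotaF.
have [w [wu uw]] := inv _ (Sl_max permutes_right_Ore Tu).
(* As t r = u - g, the element r - r u^-1 t r is r u^-1 g, a fraction of F. *)
apply: (@vn_regular_mod _ _ (w * iota t)).
have -> : iota r - iota r * (w * iota t) * iota r = iota r * w * iota g.
  have -> : iota g = iota (t * r + g) - iota t * iota r.
    by rewrite rmorphD rmorphM addrC addKr.
  by rewrite mulrBr -[_ * w * iota (_ + _)]mulrA wu mulr1 !mulrA.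
exact: fracF.
Qed.

End Criterion.

(** * Integro-differential presentations *)

(** [integro_diff phi d i]: the ring [R] is presented like the algebra of
    polynomial integro-differential operators, with [d] in the role of the
    derivation, [i] of the integration, and [phi p] of [p(h)] where [h] is the
    Euler operator [x d].  The element [1 - i * d] is then the evaluation at
    zero; the last two clauses say that the two-sided ideal that it generates
    acts faithfully on both sides.  The list of clauses is invariant under
    passing to the converse ring and swapping [d] and [i]. *)
Record integro_diff (K : fieldType) (R : nzRingType)
    (phi : {rmorphism {poly K} -> R}) (d i : R) : Prop := IntegroDiff {
  idK : d * i = 1;
  id_shiftl : forall p, d * phi p = phi (p \Po ('X + 1)) * d;
  id_shiftr : forall p, phi p * i = i * phi (p \Po ('X + 1));
  id_evall : forall p, phi p * (1 - i * d) = phi p.[0]%:P * (1 - i * d);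
  id_evalr : forall p, (1 - i * d) * phi p = (1 - i * d) * phi p.[0]%:P;
  id_neq1 : i * d <> 1;
  id_span : forall P : R -> Prop, (forall r s, P r -> P s -> P (r + s)) ->
    (forall j p k, P (i ^+ j * phi p * d ^+ k)) -> forall r, P r;
  id_faithl : forall r, (forall n, r * (i ^+ n * (1 - i * d)) = 0) -> r = 0;
  id_faithr : forall r, (forall n, (1 - i * d) * d ^+ n * r = 0) -> r = 0 }.

Section Presentation.
Variables (K : fieldType) (charK0 : [pchar K]%R =i pred0).
Variables (R : nzRingType) (phi : {rmorphism {poly K} -> R}) (d i : R).
Hypothesis H : integro_diff phi d i.

(* The evaluation at zero, an abstract variable so that distributivity does not
   expand it. *)
Variable e : R.
Hypothesis eE : e = 1 - i * d.

Lemma expdK n : d ^+ n * i ^+ n = 1.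
Proof.
elim: n => [|n IH]; first by rewrite mul1r.
by rewrite exprSr exprS -mulrA (mulrA d) (idK H) mul1r.
Qed.

Lemma expdKl m n : d ^+ (m + n) * i ^+ m = d ^+ n.
Proof. by rewrite addnC exprD -mulrA expdK mulr1. Qed.

Lemma expdKr m n : d ^+ m * i ^+ (m + n) = i ^+ n.
Proof. by rewrite exprD mulrA expdK mul1r. Qed.

Lemma de0 : d * e = 0.
Proof. by rewrite eE mulrBr mulr1 mulrA (idK H) mul1r subrr. Qed.

Lemma ei0 : e * i = 0.
Proof. by rewrite eE mulrBl mul1r -mulrA (idK H) mulr1 subrr. Qed.

Lemma expde0 n : d ^+ n.+1 * e = 0.
Proof. by rewrite exprSr -mulrA de0 mulr0. Qed.

Lemma expei0 n : e * i ^+ n.+1 = 0.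
Proof. by rewrite exprS mulrA ei0 mul0r. Qed.

Lemma eK : e * e = e.
Proof. by rewrite {1}eE mulrBl mul1r -mulrA de0 mulr0 subr0. Qed.

Lemma e_neq0 : e <> 0.
Proof.
by move=> /eqP; rewrite eE subr_eq0 => /eqP/esym; exact: (id_neq1 H).
Qed.

(** [shift n p] is the polynomial [p (X + n)]. *)
Definition shift (n : nat) (p : {poly K}) : {poly K} := p \Po ('X + n%:R%:P).

Lemma horner_shift n p x : (shift n p).[x] = p.[x + n%:R].
Proof. by rewrite horner_comp !hornerE. Qed.

Lemma shiftS n p : shift n (p \Po ('X + 1)) = shift n.+1 p.
Proof.
rewrite /shift -comp_polyA comp_polyD comp_polyX comp_polyC -addrA -rmorphD /=.
by rewrite -[in RHS]natr1.
Qed.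

Lemma expd_phi n p : d ^+ n * phi p = phi (shift n p) * d ^+ n.
Proof.
elim: n p => [|n IH] p; first by rewrite /shift addr0 comp_polyXr mul1r mulr1.
by rewrite exprSr -mulrA (id_shiftl H) mulrA IH shiftS mulrA.
Qed.

Lemma phi_expi n p : phi p * i ^+ n = i ^+ n * phi (shift n p).
Proof.
elim: n p => [|n IH] p; first by rewrite /shift addr0 comp_polyXr mul1r mulr1.
by rewrite exprS mulrA (id_shiftr H) -!mulrA IH shiftS.
Qed.

Lemma expi_phi n p : exists q, i ^+ n * phi p = phi q * i ^+ n.
Proof.
exists (p \Po ('X - n%:R%:P)); rewrite phi_expi /shift -comp_polyA.
by rewrite comp_polyB comp_polyX comp_polyC addrK comp_polyXr.
Qed.

Lemma phi_const_e c : phi c%:P * e = e * phi c%:P.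
Proof.
rewrite eE mulrBr mulrBl mulr1 mul1r mulrA (id_shiftr H) comp_polyC -!mulrA.
by rewrite (id_shiftl H) comp_polyC.
Qed.

Lemma e_phi p : e * phi p = phi p.[0]%:P * e.
Proof. by rewrite eE (id_evalr H) -eE phi_const_e. Qed.

(** The ideal of compact operators: those whose matrix in the basis of the
    [i^k e] has finitely many nonzero entries. *)
Definition compact (f : R) : Prop :=
  exists n, d ^+ n * f = 0 /\ f * i ^+ n = 0.

Lemma compact_large f : compact f ->
  exists n, forall m, (n <= m)%N -> d ^+ m * f = 0 /\ f * i ^+ m = 0.
Proof.
move=> [n [E1 E2]]; exists n => m /subnK <-; split.
  by rewrite exprD -mulrA E1 mulr0.
by rewrite addnC exprD mulrA E2 mul0r.
Qed.

Lemma compactD f g : compact f -> compact g -> compact (f + g).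
Proof.
move=> /compact_large[m Hm] /compact_large[n Hn]; exists (m + n)%N.
have [E1 E2] := Hm _ (leq_addr n m); have [E3 E4] := Hn _ (leq_addl m n).
by rewrite mulrDr mulrDl E1 E2 E3 E4 addr0.
Qed.

Lemma compactN f : compact f -> compact (- f).
Proof. by move=> [n [E1 E2]]; exists n; rewrite mulrN mulNr E1 E2 oppr0. Qed.

(** Left and right multiplications are continuous for the topologies defined by
    the powers of [d] and of [i]; hence [compact] is an ideal. *)
Lemma continuousl r n : exists m y, d ^+ m * r = y * d ^+ n.
Proof.
elim/(id_span H): r => [r s [m [y E]] [m' [y' E']]|j p k].
  exists (m' + m)%N, (d ^+ m' * y + d ^+ m * y').
  rewrite mulrDr exprD -[in LHS]mulrA E -exprD addnC exprD.
  by rewrite -[X in _ + X]mulrA E' mulrDl !mulrA.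
exists (j + n)%N, (phi (shift n p) * d ^+ k).
by rewrite !mulrA expdKl expd_phi -!mulrA -!exprD addnC.
Qed.

Lemma continuousr r n : exists m y, r * i ^+ m = i ^+ n * y.
Proof.
elim/(id_span H): r => [r s [m [y E]] [m' [y' E']]|j p k].
  exists (m + m')%N, (y * i ^+ m' + y' * i ^+ m).
  rewrite mulrDl exprD [in LHS]mulrA E -exprD addnC exprD.
  by rewrite [X in _ + X]mulrA E' mulrDr !mulrA.
exists (k + n)%N, (i ^+ j * phi (shift n p)).
by rewrite -!mulrA expdKr phi_expi !mulrA -!exprD addnC.
Qed.

Lemma compactMl r f : compact f -> compact (r * f).
Proof.
move=> /compact_large[n Hn]; have [m [y E]] := continuousl r n.
exists (n + m)%N; rewrite exprD -!mulrA (mulrA _ r) E -mulrA (Hn n _).1 //.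
by rewrite mulr0 exprD (mulrA f) (Hn n _).2 // mul0r !mulr0.
Qed.

Lemma compactMr r f : compact f -> compact (f * r).
Proof.
move=> /compact_large[n Hn]; have [m [y E]] := continuousr r n.
exists (m + n)%N; split.
  by rewrite exprD -!mulrA (mulrA _ f) (Hn n _).1 // mul0r mulr0.
by rewrite exprD -mulrA (mulrA r) E !mulrA (Hn n _).2 // !mul0r.
Qed.

Lemma compact_not1 : ~ compact 1.
Proof.
move=> [n [E _]]; have /eqP := oner_neq0 R; apply.
by rewrite -(expdK n) -[d ^+ n]mulr1 E mul0r.
Qed.

Lemma compact0 : compact 0.
Proof. by exists 0%N; rewrite mulr0 mul0r. Qed.

Lemma compact_e : compact e.
Proof. by exists 1%N; rewrite !expr1 de0 ei0. Qed.

Lemma compact_proj n : compact (1 - i ^+ n * d ^+ n).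
Proof.
exists n; rewrite mulrBr mulrBl mulr1 mul1r mulrA expdK mul1r.
by rewrite -mulrA expdK mulr1 !subrr.
Qed.

Lemma compact_expi_cancel n r : compact (i ^+ n * r) -> compact r.
Proof.
by move=> /(compactMl (d ^+ n)); rewrite mulrA expdK mul1r.
Qed.

Lemma compact_faithful r : (forall f, compact f -> f * r = 0) -> r = 0.
Proof.
move=> Hr; apply: (id_faithr H) => n; rewrite -eE; apply: Hr.
exact/compactMr/compact_e.
Qed.

(** * Compact operators are finite matrices *)

Lemma corner r : exists c : K, e * r * e = phi c%:P * e.
Proof.
elim/(id_span H): r => [r s [a Ea] [b Eb]|j p k].
  by exists (a + b); rewrite mulrDr mulrDl Ea Eb polyCD rmorphD mulrDl.
case: j => [|j]; last by exists 0; rewrite !mulrA expei0 !mul0r rmorph0 mul0r.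
case: k => [|k]; last by exists 0; rewrite -!mulrA expde0 !mulr0 rmorph0 mul0r.
by exists p.[0]; rewrite mul1r mulr1 e_phi -mulrA eK.
Qed.

(** The matrix units [i^j e d^k] multiply as expected. *)
Lemma unitM j k : e * d ^+ j * (i ^+ k * e) = if j == k then e else 0.
Proof.
case: ltngtP => [lt|lt|->].
- rewrite -[k](subnKC (ltnW lt)) -!mulrA (mulrA (d ^+ j)) expdKr.
  by rewrite -[(k - j)%N]prednK ?subn_gt0 // mulrA expei0 mul0r.
- rewrite -[j](subnKC (ltnW lt)) -!mulrA (mulrA (d ^+ _)) expdKl.
  by rewrite -[(j - k)%N]prednK ?subn_gt0 // expde0 mulr0.
- by rewrite -mulrA (mulrA (d ^+ k)) expdK mul1r eK.
Qed.

Lemma proj_sum n : 1 - i ^+ n * d ^+ n = \sum_(j < n) i ^+ j * e * d ^+ j.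
Proof.
elim: n => [|n IH]; first by rewrite big_ord0 mul1r subrr.
rewrite big_ord_recr /= -IH eE mulrBr mulr1 mulrBl exprSr exprS -!mulrA.
by rewrite addrA subrK.
Qed.

(** The element of [R] acting as the matrix [A] on the first [n] basis
    vectors, and killing the other ones. *)
Definition mx_elt n (A : 'M[K]_n) : R :=
  \sum_j \sum_k i ^+ (j : 'I_n) * (phi (A j k)%:P * e) * d ^+ (k : 'I_n).

Lemma mx_eltM n (A B : 'M[K]_n) : mx_elt A * mx_elt B = mx_elt (A *m B).
Proof.
have unit_scaledM (j k l m : 'I_n) (a b : K) :
    i ^+ j * (phi a%:P * e) * d ^+ k * (i ^+ l * (phi b%:P * e) * d ^+ m)
    = if k == l then i ^+ j * (phi (a * b)%:P * e) * d ^+ m else 0.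
  have -> :
      i ^+ j * (phi a%:P * e) * d ^+ k * (i ^+ l * (phi b%:P * e) * d ^+ m)
      = i ^+ j * phi a%:P * (e * d ^+ k * (i ^+ l * e)) * phi b%:P * d ^+ m.
    by rewrite (phi_const_e b) !mulrA.
  rewrite unitM -val_eqE; case: eqP => _; last by rewrite !mulr0 !mul0r.
  by rewrite -(mulrA _ e) -phi_const_e polyCM rmorphM !mulrA.
rewrite /mx_elt mulr_suml; apply: eq_bigr => j _; rewrite mulr_suml.
transitivity (\sum_l \sum_k
    i ^+ (j : 'I_n) * (phi (A j l * B l k)%:P * e) * d ^+ (k : 'I_n)).
  apply: eq_bigr => l _; rewrite mulr_sumr (bigD1 l) //= [X in _ + X]big1.
    rewrite addr0 mulr_sumr; apply: eq_bigr => k _.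
    by rewrite unit_scaledM eqxx.
  move=> m ml; rewrite mulr_sumr big1 // => k _.
  by rewrite unit_scaledM eq_sym (negbTE ml).
rewrite exchange_big; apply: eq_bigr => k _ /=.
by rewrite mxE -mulr_suml -mulr_sumr -mulr_suml !rmorph_sum.
Qed.

Lemma compact_mx f : compact f -> exists n (A : 'M[K]_n), f = mx_elt A.
Proof.
move=> [n [E1 E2]]; exists n.
have [c Hc] := choice (fun jk : 'I_n * 'I_n =>
  corner (d ^+ jk.1 * f * i ^+ jk.2)).
exists (\matrix_(j, k) c (j, k)).
have -> : f = (1 - i ^+ n * d ^+ n) * f * (1 - i ^+ n * d ^+ n).
  rewrite mulrBl mul1r -mulrA E1 mulr0 subr0 mulrBr mulr1 mulrA E2 mul0r.
  by rewrite subr0.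
rewrite proj_sum /mx_elt -mulrA mulr_suml; apply: eq_bigr => j _.
rewrite !mulr_sumr; apply: eq_bigr => k _.
by rewrite mxE -Hc !mulrA.
Qed.

Lemma compact_vnr f : compact f -> vn_regular f.
Proof.
move=> /compact_mx[n [A ->]]; exists (mx_elt (pinvmx A)).
by rewrite !mx_eltM mulmxKpV.
Qed.

(** * Polynomials in the integration and the Euler operator *)

(** [ipoly n a]: [a] is a sum of terms [i^j phi (p_j)] with [j < n], written in
    Horner form. *)
Fixpoint ipoly (n : nat) (a : R) : Prop :=
  if n is n'.+1 then exists p b, ipoly n' b /\ a = phi p + i * b else a = 0.

Lemma ipoly0 n : ipoly n 0.
Proof.
elim: n => //= n IH; exists 0, 0; split=> //.
by rewrite rmorph0 mulr0 addr0.
Qed.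

Lemma ipolyS n a : ipoly n a -> ipoly n.+1 a.
Proof.
elim: n a => [|n IH] a; first by move=> ->; exact: ipoly0.
by move=> [p [b [Hb ->]]]; exists p, b; split=> //; exact: IH.
Qed.

Lemma ipolyW m n a : (m <= n)%N -> ipoly m a -> ipoly n a.
Proof. by move=> /subnK <-; elim: (n - m)%N => // k IH /IH; exact: ipolyS. Qed.

Lemma ipolyD n a b : ipoly n a -> ipoly n b -> ipoly n (a + b).
Proof.
elim: n a b => [|n IH] a b /=; first by move=> -> ->; rewrite addr0.
move=> [p [a' [Ha ->]]] [q [b' [Hb ->]]]; exists (p + q), (a' + b').
by split; [exact: IH|rewrite rmorphD mulrDr addrACA].
Qed.

Lemma ipoly_phi p : ipoly 1 (phi p).
Proof. by exists p, 0; rewrite mulr0 addr0. Qed.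

Lemma ipoly_i n a : ipoly n a -> ipoly n.+1 (i * a).
Proof. by move=> Ha; exists 0, a; rewrite rmorph0 add0r. Qed.

Lemma ipoly_expi m n a : ipoly n a -> ipoly (m + n) (i ^+ m * a).
Proof.
elim: m => [|m IH] Ha; first by rewrite mul1r.
by rewrite exprS -mulrA; apply/ipoly_i/IH.
Qed.

Lemma ipoly_phiM p n a : ipoly n a -> ipoly n (phi p * a).
Proof.
elim: n p a => [|n IH] p a /=; first by move=> ->; rewrite mulr0.
move=> [q [b [Hb ->]]]; exists (p * q), (phi (p \Po ('X + 1)) * b).
by split; [exact: IH|rewrite mulrDr rmorphM !mulrA (id_shiftr H)].
Qed.

Lemma ipolyM m n a b : ipoly m a -> ipoly n b -> ipoly (m + n) (a * b).
Proof.
elim: m a => [|m IH] a; first by move=> -> _; rewrite mul0r; exact: ipoly0.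
move=> [p [a' [Ha ->]]] Hb; rewrite mulrDl -mulrA; apply: ipolyD.
  by apply: ipolyW (ipoly_phiM p Hb); rewrite leq_addl.
by rewrite addSn; apply/ipoly_i/IH.
Qed.

(** [ipoly n] is stable under conjugation by [i], both ways. *)
Lemma ipoly_conjl n a : ipoly n a -> exists2 b, ipoly n b & i * a = b * i.
Proof.
elim: n a => [|n IH] a; first by move=> ->; exists 0; rewrite // mulr0 mul0r.
move=> [p [b [/IH[c Hc E] ->]]].
have [q Hq] := expi_phi 1 p; rewrite !expr1 in Hq.
exists (phi q + i * c); first by exists q, c.
by rewrite mulrDr Hq E mulrDl !mulrA.
Qed.

Lemma ipoly_conjr n a : ipoly n a -> exists2 b, ipoly n b & a * i = i * b.
Proof.
elim: n a => [|n IH] a; first by move=> ->; exists 0; rewrite // mulr0 mul0r.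
move=> [p [b [/IH[c Hc E] ->]]].
exists (phi (p \Po ('X + 1)) + i * c); first by exists (p \Po ('X + 1)), c.
by rewrite mulrDl (id_shiftr H) -mulrA E mulrDr.
Qed.

Lemma ipoly_stable n a m : ipoly n a -> exists y, a * i ^+ m = i ^+ m * y.
Proof.
elim: m a => [|m IH] a Ha; first by exists a; rewrite mulr1 mul1r.
have [b Hb E] := ipoly_conjr Ha; have [y Ey] := IH b Hb.
by exists y; rewrite exprS mulrA E -mulrA Ey mulrA.
Qed.

(** [triangular c u]: the matrix of [u] in the basis of the [i^n e] is lower
    triangular, with diagonal [c]. *)
Definition triangular (c : nat -> K) (u : R) : Prop := forall n,
  (exists y, u * i ^+ n = i ^+ n * y)
  /\ e * d ^+ n * u * i ^+ n = phi (c n)%:P * e.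

Lemma triangularD c c' u v : triangular c u -> triangular c' v ->
  triangular (fun n => c n + c' n) (u + v).
Proof.
move=> Hu Hv n; have [[y Ey] Eu] := Hu n; have [[z Ez] Ev] := Hv n; split.
  by exists (y + z); rewrite mulrDl mulrDr Ey Ez.
by rewrite mulrDr mulrDl Eu Ev polyCD rmorphD mulrDl.
Qed.

Lemma triangularM c c' u v : triangular c u -> triangular c' v ->
  triangular (fun n => c n * c' n) (u * v).
Proof.
move=> Hu Hv n; have [[y Ey] Eu] := Hu n; have [[z Ez] Ev] := Hv n; split.
  by exists (y * z); rewrite -mulrA Ez mulrA Ey mulrA.
have ez : e * z = phi (c' n)%:P * e.
  by rewrite -Ev -[RHS]mulrA Ez -!mulrA (mulrA (d ^+ n)) expdK mul1r.
rewrite !mulrA -(mulrA _ v) Ez !mulrA Eu -mulrA ez mulrA -rmorphM.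
by rewrite -polyCM.
Qed.

Lemma triangular_ipoly p n b : ipoly n b ->
  triangular (fun m => p.[m%:R]) (phi p + i * b).
Proof.
move=> Hb m; have [y Ey] := ipoly_stable m Hb.
have E : (phi p + i * b) * i ^+ m = i ^+ m * (phi (shift m p) + i * y).
  by rewrite mulrDl phi_expi -mulrA Ey mulrDr !mulrA -exprS -exprSr.
split; first by exists (phi (shift m p) + i * y).
rewrite -mulrA E -mulrA (mulrA (d ^+ m)) expdK mul1r.
by rewrite mulrDr mulrA ei0 mul0r addr0 e_phi horner_shift add0r.
Qed.

Lemma triangular_conj k c u : triangular c u ->
  triangular (fun n => c (k + n)%N) (d ^+ k * u * i ^+ k).
Proof.
move=> Hu n; have [[y Ey] Eu] := Hu (k + n)%N; split.
  exists y; rewrite -!mulrA -exprD Ey exprD -!mulrA.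
  by rewrite (mulrA (d ^+ k)) expdK mul1r.
have Ed : d ^+ (k + n) = d ^+ n * d ^+ k by rewrite addnC exprD.
by rewrite -Eu Ed exprD !mulrA.
Qed.

Lemma triangular_unit m :
  triangular (fun n => (n == m)%:R) (i ^+ m * e * d ^+ m).
Proof.
move=> n; split.
  have [le|lt] := leqP n m.
    exists (i ^+ (m - n) * e * d ^+ m * i ^+ n).
    by rewrite !mulrA -exprD subnKC.
  exists 0; rewrite -(subnKC (ltnW lt)) -!mulrA expdKr mulr0.
  by rewrite -[(n - m)%N]prednK ?subn_gt0 // expei0 !mulr0.
rewrite !mulrA -(mulrA (e * d ^+ n)) unitM.
case: eqP => [->|_]; last by rewrite !mul0r polyC0 rmorph0 mul0r.
by rewrite -mulrA expdK mulr1 polyC1 rmorph1 mul1r.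
Qed.

Lemma phi_const_cancel c x : c != 0 -> phi c%:P * x = 0 -> x = 0.
Proof.
move=> c0 /(congr1 (fun y => phi c^-1%:P * y)).
by rewrite mulr0 mulrA -rmorphM -polyCM mulVf // polyC1 rmorph1 mul1r.
Qed.

Lemma triangular_compact c u : triangular c u -> compact u ->
  exists N, forall n, (N <= n)%N -> c n = 0.
Proof.
move=> Hu /compact_large[N HN]; exists N => n /HN[_ E].
have [_] := Hu n; rewrite -mulrA E mulr0 => /esym E'.
apply/eqP/negP => /negP c0; apply: e_neq0; exact: phi_const_cancel E'.
Qed.

(** In characteristic zero, a nonzero polynomial has finitely many roots among
    the natural numbers. *)
Lemma poly_eventually_neq0 (p : {poly K}) : p != 0 ->
  exists N, forall n, (N <= n)%N -> p.[n%:R] != 0.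
Proof.
have [m] := ubnP (size p); elim: m p => // m IH p lt p0.
have [Hp|Hp] := pselect (exists n : nat, root p n%:R); last first.
  exists 0%N => n _; apply/negP => r; apply: Hp; exists n; exact: r.
case: Hp => n /factor_theorem[q Eq].
have q0 : q != 0 by apply: contraNneq p0 => q0; rewrite Eq q0 mul0r.
have [|//|N HN] := IH q.
  by move: lt; rewrite Eq size_Mmonic ?monicXsubC // size_XsubC addn2 /= ltnS.
exists (maxn N n.+1) => k; rewrite geq_max => /andP[Nk nk].
rewrite Eq hornerM mulf_neq0 ?HN // !hornerE -natrB 1?ltnW //.
by rewrite (iffLR (pcharf0P K) charK0) -lt0n subn_gt0.
Qed.

Lemma phi_neq0 p : p != 0 -> phi p <> 0.
Proof.
move=> /poly_eventually_neq0[M HM] E.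
have := triangular_ipoly p (ipoly0 0); rewrite E mulr0 addr0.
move=> /triangular_compact/(_ compact0)[N HN].
have /eqP := HM _ (leq_addl N M); apply.
exact/HN/leq_addr.
Qed.

(** After division by a power of [i], a nonzero polynomial element has a nonzero
    constant term [p], which gives the diagonal [p(m)]. *)
Lemma ipoly_lead n a : ipoly n a -> a <> 0 -> exists k p u,
  [/\ p != 0, a = i ^+ k * u & triangular (fun m => p.[m%:R]) u].
Proof.
elim: n a => // n IH a [p [b [Hb Ea]]] a0.
have [p0|p0] := eqVneq p 0; last first.
  by exists 0%N, p, a; rewrite mul1r Ea; split=> //; exact: triangular_ipoly Hb.
have {}Ea : a = i * b by rewrite Ea p0 rmorph0 add0r.
have [|k [q [u [q0 Eb Hu]]]] := IH b Hb.
  by move=> b0; apply: a0; rewrite Ea b0 mulr0.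
by exists k.+1, q, u; rewrite exprS -mulrA -Eb.
Qed.

(** The image of [ipoly] in the quotient by the compact operators is a
    domain. *)
Lemma ipoly_domain m n a b : ipoly m a -> ipoly n b -> a <> 0 -> b <> 0 ->
  ~ compact (a * b).
Proof.
move=> Ha Hb /(ipoly_lead Ha)[k [p [u [p0 -> Hu]]]].
move=> /(ipoly_lead Hb)[l [q [v [q0 -> Hv]]]].
rewrite -mulrA => /compact_expi_cancel /(compactMl (d ^+ l)).
rewrite !mulrA => /(triangular_compact (triangularM (triangular_conj l Hu) Hv)).
move=> [N HN]; have [P HP] := poly_eventually_neq0 p0.
have [Q HQ] := poly_eventually_neq0 q0.
have /eqP := HN (N + P + Q)%N (leq_trans (leq_addr _ _) (leq_addr _ _)).
rewrite mulf_eq0 (negbTE (HQ _ _)) ?leq_addl // orbF; apply/negP/HP.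
by rewrite addnCA -addnA addnCA leq_addr.
Qed.

(** Up to compact operators, each element becomes polynomial after a left
    multiplication by a power of [i]. *)
Lemma normal_form r : exists m n a, ipoly n a /\ compact (i ^+ m * r - a).
Proof.
elim/(id_span H): r => [r s [m [n [a [Ha Ka]]]] [m' [n' [b [Hb Kb]]]]|j p k].
  exists (m + m')%N, (m' + n + (m + n'))%N, (i ^+ m' * a + i ^+ m * b); split.
    apply: ipolyD; first by apply: ipolyW (ipoly_expi m' Ha); exact: leq_addr.
    by apply: ipolyW (ipoly_expi m Hb); exact: leq_addl.
  have -> : i ^+ (m + m') * (r + s) - (i ^+ m' * a + i ^+ m * b)
      = i ^+ m' * (i ^+ m * r - a) + i ^+ m * (i ^+ m' * s - b).
    rewrite !mulrBr mulrDr !mulrA -!exprD (addnC m') opprD.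
    by rewrite addrACA.
  by apply: compactD; exact: compactMl.
have [q Eq] := expi_phi k p.
exists k, (j + 1)%N, (i ^+ j * phi q); split; first exact/ipoly_expi/ipoly_phi.
have -> : i ^+ k * (i ^+ j * phi p * d ^+ k) - i ^+ j * phi q
    = - (i ^+ j * phi q) * (1 - i ^+ k * d ^+ k).
  rewrite !mulrA -exprD addnC exprD -[_ * _ * phi p]mulrA Eq mulrBr mulr1.
  by rewrite addrC mulNr opprK !mulrA.
exact/compactMl/compact_proj.
Qed.

(** Two polynomial elements have a nontrivial common left multiple: a Euclidean
    algorithm on the constant terms. *)
Lemma ipoly_Ore m n a b : ipoly m a -> ipoly n b ->
  exists k l p q, [/\ ipoly k p, ipoly l q, p <> 0 \/ q <> 0 & p * a = q * b].
Proof.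
have one_neq0 : (1 : R) <> 0 by apply/eqP; rewrite oner_eq0.
have ipoly1 : ipoly 1 1 by rewrite -(rmorph1 phi); exact: ipoly_phi.
have i_inj x : i * x = 0 -> x = 0.
  by move=> E; rewrite -[x]mul1r -(idK H) -mulrA E mulr0.
have conj_neq0 k x y : ipoly k y -> i * x = y * i -> x <> 0 -> y <> 0.
  by move=> _ E x0 y0; apply/x0/i_inj; rewrite E y0 mul0r.
have [N] := ubnP (m + n); elim: N m n a b => // N IH m n a b lt Ha Hb.
wlog le : m n a b lt Ha Hb / (n <= m)%N.
  move=> W; case: (leqP n m) => [/W|/ltnW/W]; first exact.
  rewrite addnC; case/(_ _ _ lt Hb Ha) => k [l [p [q [Hp Hq p0 E]]]].
  by exists l, k, q, p; split=> //; case: p0; [right|left].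
case: n m le lt Ha Hb => [|n] m.
  move=> _ _ _ ->; exists 0%N, 1%N, 0, 1.
  by split=> //; [right|rewrite mul0r mulr0].
case: m => // m le lt Ha Hb; have [al [a' [Ha' Ea]]] := Ha.
have [be [b' [Hb' Eb]]] := Hb.
have [be0|be0] := eqVneq be 0.
  have {}Eb : b = i * b' by rewrite Eb be0 rmorph0 add0r.
  have [|k [l [p [q [Hp Hq pq E]]]]] := IH m.+1 n a b' _ Ha Hb'.
    by move: lt; rewrite addnS.
  have [q' Hq' Eq'] := ipoly_conjl Hq.
  exists k.+1, l, (i * p), q'; split=> //; first exact: ipoly_i.
    case: pq => [p0|q0]; [left => /i_inj //|right].
    exact: conj_neq0 Hq' Eq' q0.
  by rewrite -mulrA E mulrA Eq' -mulrA -Eb.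
pose c := phi (be \Po ('X + 1)) * a' + - phi (al \Po ('X + 1)) * b'.
have Hc : ipoly m c.
  apply: ipolyD; first exact: ipoly_phiM.
  by rewrite -rmorphN; apply: ipoly_phiM; apply: ipolyW Hb'.
(* The constant terms of phi be * a and phi al * b cancel. *)
have Ec : i * c = phi be * a - phi al * b.
  have phiC : phi be * phi al = phi al * phi be by rewrite -!rmorphM mulrC.
  rewrite /c mulrDr mulNr mulrN !mulrA -!(id_shiftr H) Ea Eb !(mulrDr (phi _)).
  by rewrite phiC opprD addrACA subrr add0r !mulrA.
have [|k [l [p [q [Hp Hq pq E]]]]] := IH m n.+1 c b _ Hc Hb.
  by move: lt; rewrite addSn.
have [p0|p0] := pselect (p = 0).
  exists k, l, p, q; split=> //.
  by rewrite -E p0 !mul0r.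
have [p' Hp' Ep'] := ipoly_conjl Hp.
exists (k + 1)%N, (l.+1 + (k + 1))%N, (p' * phi be),
  (i * q + p' * phi al); split.
- exact/ipolyM/ipoly_phi.
- apply: ipolyD; first by apply: ipolyW (ipoly_i Hq); exact: leq_addr.
  by apply: ipolyW (ipolyM Hp' (ipoly_phi al)); exact: leq_addl.
- left=> E0; apply: (ipoly_domain Hp' (ipoly_phi be)).
  + exact: conj_neq0 Hp' Ep' p0.
  + exact: phi_neq0.
  + by rewrite E0; exact: compact0.
- rewrite mulrDl -!mulrA -E (mulrA i p) Ep' -mulrA Ec -mulrDr.
  by rewrite subrK.
Qed.

Lemma compact_Ore r s : ~ compact s ->
  exists p q, ~ compact p /\ compact (p * r - q * s).
Proof.
move=> Fs; have [m [n [a [Ha Ka]]]] := normal_form r.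
have [m' [n' [b [Hb Kb]]]] := normal_form s.
have b0 : b <> 0.
  by move=> b0; move: Kb; rewrite b0 subr0 => /compact_expi_cancel.
have [k [l [p [q [Hp Hq pq E]]]]] :=
  ipoly_Ore (ipoly_expi m' Ha) (ipoly_expi m Hb).
have p0 : p <> 0.
  move=> p0; case: pq => // q0; apply: (ipoly_domain Hq (ipoly_expi m Hb) q0).
    move=> /(congr1 (fun x => d ^+ m * x)); rewrite mulrA expdK mul1r mulr0.
    exact: b0.
  by rewrite -E p0 mul0r; exact: compact0.
have Hi j : ipoly (j + 1) (i ^+ j).
  by rewrite -[i ^+ j]mulr1 -(rmorph1 phi); exact/ipoly_expi/ipoly_phi.
exists (p * i ^+ (m' + m)), (q * i ^+ (m + m')); split.
  apply: (ipoly_domain Hp (Hi _)) => // /(congr1 (fun x => d ^+ (m' + m) * x)).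
  by rewrite expdK mulr0 => /eqP; rewrite oner_eq0.
have -> : p * i ^+ (m' + m) * r - q * i ^+ (m + m') * s
    = p * i ^+ m' * (i ^+ m * r - a) - q * i ^+ m * (i ^+ m' * s - b).
  by rewrite !mulrBr !exprD !mulrA in E *; rewrite E opprB addrA subrK.
by apply: compactD; [|apply: compactN]; exact: compactMl.
Qed.

(** A compact correction makes the first [N] diagonal entries nonzero and keeps
    the other ones. *)
Lemma triangular_repair c u N : triangular c u -> exists g c',
  [/\ compact g, triangular c' (u + g), forall n, (n < N)%N -> c' n != 0
    & forall n, (N <= n)%N -> c' n = c n].
Proof.
move=> Hu; elim: N => [|N [g [c' [Kg Hg nz eq]]]].
  by exists 0, c; rewrite addr0; split=> //; exact: compact0.
have [cN|cN] := eqVneq (c' N) 0; last first.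
  exists g, c'; split=> // n; last by move=> /ltnW; exact: eq.
  by rewrite ltnS leq_eqVlt => /orP[/eqP -> //|]; exact: nz.
exists (g + i ^+ N * e * d ^+ N), (fun n => c' n + (n == N)%:R); split.
- by apply: compactD => //; exact/compactMr/compactMl/compact_e.
- by rewrite addrA; apply: triangularD => //; exact: triangular_unit.
- move=> n; rewrite ltnS leq_eqVlt => /orP[/eqP ->|lt].
    by rewrite cN eqxx add0r oner_eq0.
  by rewrite (ltn_eqF lt) addr0; exact: nz.
- by move=> n lt; rewrite (gtn_eqF lt) addr0; apply/eq/ltnW.
Qed.

Lemma triangular_permutes c u : triangular c u -> (forall n, c n != 0) ->
  permutes_right compact u.
Proof.
move=> Hu nz; split=> f [n [_ En]].
  elim: n En => [|n IH] En fu; first by rewrite mulr1 in En.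
  apply: IH => //; have [[y Ey] Eu] := Hu n.
  have ey : e * y = phi (c n)%:P * e.
    by rewrite -Eu -[RHS]mulrA Ey -!mulrA (mulrA (d ^+ n)) expdK mul1r.
  have fe : f * i ^+ n = f * i ^+ n * e.
    by rewrite eE mulrBr mulr1 !mulrA -(mulrA f) -exprSr En mul0r subr0.
  have : f * i ^+ n * e * phi (c n)%:P = 0.
    by rewrite -mulrA -phi_const_e -ey mulrA -fe -mulrA -Ey mulrA fu mul0r.
  move=> /(congr1 (fun x => x * phi (c n)^-1%:P)).
  by rewrite mul0r -mulrA -rmorphM -polyCM mulfV // polyC1 rmorph1 mulr1 -fe.
elim: n f En => [|n IH] f En.
  by exists 0; rewrite ?mul0r; [exact: compact0|rewrite mulr1 in En].
have [[y Ey] Eu] := Hu n.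
pose f1 := f * i ^+ n * e * phi (c n)^-1%:P * d ^+ n.
have [|f2 K2 E2] := IH (f - f1 * u).
  rewrite mulrBl; have -> : f1 * u * i ^+ n = f * i ^+ n * e.
    have -> : f1 * u * i ^+ n
        = f * i ^+ n * phi (c n)^-1%:P * (e * d ^+ n * u * i ^+ n).
      by rewrite /f1 -(mulrA _ e) -phi_const_e !mulrA.
    rewrite Eu mulrA -(mulrA (f * i ^+ n)) -rmorphM -polyCM mulVf //.
    by rewrite polyC1 rmorph1 mulr1.
  by rewrite eE mulrBr mulr1 !mulrA -(mulrA f) -exprSr En mul0r subr0 subrr.
exists (f2 + f1); last by rewrite mulrDl E2 subrK.
apply: compactD => //; rewrite /f1 -!mulrA mulrA.
exact/compactMl/compactMr/compact_e.
Qed.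

Lemma compact_lift s : ~ compact s ->
  exists t g, compact g /\ permutes_right compact (t * s + g).
Proof.
move=> Fs; have [m [n [a [Ha Ka]]]] := normal_form s.
have a0 : a <> 0.
  by move=> a0; move: Ka; rewrite a0 subr0 => /compact_expi_cancel.
have [k [p [u [p0 Ea Hu]]]] := ipoly_lead Ha a0.
have [N HN] := poly_eventually_neq0 p0.
have [g [c' [Kg Hg nz eq]]] := triangular_repair N Hu.
exists (d ^+ k * i ^+ m), (g - d ^+ k * (i ^+ m * s - a)); split.
  by apply: compactD => //; exact/compactN/compactMl.
have -> : d ^+ k * i ^+ m * s + (g - d ^+ k * (i ^+ m * s - a)) = u + g.
  rewrite mulrBr Ea !mulrA expdK mul1r opprB.
  by rewrite addrCA addrC [X in X + g]addrCA subrr addr0.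
apply: (triangular_permutes Hg) => j.
by case: (ltnP j N) => [/nz //|le]; rewrite eq // HN.
Qed.

Lemma integro_diff_Ql_vnr (q : Ql R) : vn_regular q.
Proof.
apply: (largest_left_quotient_vnr (F := compact)).
- exact: compactMl.
- exact: compactMr.
- exact: compact_not1.
- exact: compact_faithful.
- exact: compact_vnr.
- exact: compact_Ore.
- exact: compact_lift.
Qed.

End Presentation.

(** * The converse of an integro-differential presentation *)

Lemma converse_expr (R : nzRingType) (x : R) n :
  (x : R^c) ^+ n = (x ^+ n : R).
Proof. by elim: n => // n IH; rewrite exprS exprSr IH. Qed.

Lemma integro_diff_converse (K : fieldType) (R : nzRingType)
    (phi : {rmorphism {poly K} -> R}) (d i : R) : integro_diff phi d i ->
  exists psi : {rmorphism {poly K} -> R^c},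
    integro_diff psi (i : R^c) (d : R^c).
Proof.
move=> H.
pose f : {poly K} -> R^c := phi.
have fB : {morph f : x y / x - y} by exact: (rmorphB phi).
have fM : monoid_morphism f.
  split=> [|p q]; first exact: (rmorph1 phi).
  by rewrite /f mulrC; exact: (rmorphM phi q p).
pose mB := GRing.isZmodMorphism.Build {poly K} R^c f fB.
pose mM := GRing.isMonoidMorphism.Build {poly K} R^c f fM.
pose psi : {rmorphism {poly K} -> R^c} := HB.pack f mB mM.
exists psi; split.
- exact: (idK H).
- exact: (id_shiftr H).
- exact: (id_shiftl H).
- exact: (id_evalr H).
- exact: (id_evall H).
- exact: (id_neq1 H).
- move=> P PD Pm; apply: (id_span H) => // j p k.
  have := Pm k p j; rewrite !converse_expr.
  by rewrite -[X in P X -> _]/(i ^+ j * (phi p * d ^+ k) : R) mulrA.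
- move=> r Hr; apply: (id_faithr H) => n; rewrite -(Hr n) converse_expr.
  by [].
- move=> r Hr; apply: (id_faithl H) => n; rewrite -(Hr n) converse_expr.
  by [].
Qed.

(** * Polynomial integro-differential operators *)

Section I1Presentation.
Variables (K : fieldType) (charK0 : [pchar K]%R =i pred0).

Lemma I1_gen_x : @end_x K \in @I1_pred K.
Proof. by apply/asboolP => A []. Qed.
Lemma I1_gen_d : @end_d K \in @I1_pred K.
Proof. by apply/asboolP => A []. Qed.
Lemma I1_gen_int : @end_int K \in @I1_pred K.
Proof. by apply/asboolP => A []. Qed.

Definition I1_x : I1 K :=
  exist (fun f : poly_end K => f \in @I1_pred K) (@end_x K) I1_gen_x.
Definition I1_d : I1 K :=
  exist (fun f : poly_end K => f \in @I1_pred K) (@end_d K) I1_gen_d.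
Definition I1_int : I1 K :=
  exist (fun f : poly_end K => f \in @I1_pred K) (@end_int K) I1_gen_int.

(** The action of an operator on a polynomial. *)
Definition act (f : I1 K) (p : {poly K}) : {poly K} := end_app (val f) p.

Lemma actM f g p : act (f * g) p = act f (act g p). Proof. by []. Qed.
Lemma actD f g p : act (f + g) p = act f p + act g p. Proof. by []. Qed.
Lemma actB f g p : act (f - g) p = act f p - act g p. Proof. by []. Qed.
Lemma act1 p : act 1 p = p. Proof. by []. Qed.
Lemma act0 p : act 0 p = 0. Proof. by []. Qed.
Lemma actZl a f p : act (a *: f) p = a *: act f p. Proof. by []. Qed.
Lemma actZr a f p : act f (a *: p) = a *: act f p.
Proof. by rewrite /act /end_app linearZ. Qed.

Lemma act_ext f g : (forall n, act f 'X^n = act g 'X^n) -> f = g.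
Proof.
move=> E; apply/val_inj/poly_endP => p; rewrite -[p]coefK poly_def /end_app.
rewrite !linear_sum; apply: eq_bigr => n _; rewrite !linearZ.
by congr (_ *: _); exact: E.
Qed.

Lemma act_x n : act I1_x 'X^n = 'X^(n.+1).
Proof. by rewrite exprS. Qed.
Lemma act_d n : act I1_d 'X^n = n%:R *: 'X^(n.-1).
Proof. by rewrite /act /end_app /= derivXn scaler_nat. Qed.
Lemma act_int n : act I1_int 'X^n = n.+1%:R^-1 *: 'X^(n.+1).
Proof. exact: poly_int_Xn. Qed.

(** The polynomials in the Euler operator [x d]. *)
Definition I1_euler : {rmorphism {poly K} -> I1 K} := horner_alg (I1_x * I1_d).

Lemma act_euler p n : act (I1_euler p) 'X^n = p.[n%:R] *: 'X^n.
Proof.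
elim/poly_ind: p => [|p c IH]; first by rewrite rmorph0 horner0 scale0r.
rewrite rmorphD rmorphM /= horner_algX horner_algC actD !actM act_d actZr act_x.
rewrite -/I1_euler.
have -> : n%:R *: 'X^(n.-1.+1) = n%:R *: 'X^n :> {poly K}.
  by case: n {IH} => // ; rewrite !scale0r.
by rewrite actZr IH actZl act1 scalerA !hornerE -scalerDl mulrC.
Qed.

Lemma natS_neq0 n : n.+1%:R != 0 :> K.
Proof. by rewrite (iffLR (pcharf0P K) charK0). Qed.

Lemma act_eval0 p : act (1 - I1_int * I1_d) p = p`_0 *: 'X^0.
Proof.
rewrite actB act1 actM; apply/polyP => -[|n];
  rewrite coefB coef_poly_int coefZ coefXn ?subr0 ?mulr1 //.
by rewrite coef_deriv -[p`__ *+ _]mulr_natr mulfK ?natS_neq0 // subrr mulr0.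
Qed.

Lemma act_expd n p : act (I1_d ^+ n) p = p^`(n).
Proof. by elim: n => // n IH; rewrite exprS actM IH derivnS. Qed.

Lemma act_expint n : act (I1_int ^+ n) 'X^0 = n`!%:R^-1 *: 'X^n.
Proof.
elim: n => [|n IH]; first by rewrite act1 fact0 invr1 scale1r.
by rewrite exprS actM IH actZr act_int scalerA factS natrM invfM mulrC.
Qed.

Lemma I1_intK : I1_d * I1_int = 1.
Proof.
apply: act_ext => n; rewrite actM act_int actZr act_d scalerA.
by rewrite mulVf ?natS_neq0 // scale1r.
Qed.

Lemma I1_shiftl p : I1_d * I1_euler p = I1_euler (p \Po ('X + 1)) * I1_d.
Proof.
apply: act_ext => n; rewrite !actM act_euler act_d !actZr act_d act_euler.
rewrite !scalerA horner_comp !hornerE.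
case: n => [|n]; first by rewrite mulr0 mul0r.
by rewrite natr1 mulrC.
Qed.

Lemma I1_shiftr p : I1_euler p * I1_int = I1_int * I1_euler (p \Po ('X + 1)).
Proof.
apply: act_ext => n; rewrite !actM act_euler act_int !actZr act_int act_euler.
by rewrite !scalerA horner_comp !hornerE natr1 mulrC.
Qed.

Lemma I1_xE : I1_x = I1_int * I1_euler ('X + 1).
Proof.
apply: act_ext => n; rewrite actM act_x act_euler actZr act_int scalerA.
by rewrite !hornerE natr1 mulfV ?natS_neq0 // scale1r.
Qed.

(** The operators that are sums of monomials [int^j p(h) d^k]. *)
Inductive I1_spanned : I1 K -> Prop :=
| I1_monomial j p k : I1_spanned (I1_int ^+ j * I1_euler p * I1_d ^+ k)
| I1_spannedD r s : I1_spanned r -> I1_spanned s -> I1_spanned (r + s).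

Lemma I1_spannedZ a r : I1_spanned r -> I1_spanned (a *: r).
Proof.
elim=> [j p k|s t _ Hs _ Ht]; last by rewrite scalerDr; exact: I1_spannedD.
rewrite scalerAl scalerAr.
have -> : a *: I1_euler p = I1_euler (a *: p).
  by apply: act_ext => n; rewrite actZl !act_euler hornerZ scalerA.
exact: I1_monomial.
Qed.

Lemma I1_spanned_int r : I1_spanned r -> I1_spanned (I1_int * r).
Proof.
elim=> [j p k|s t _ Hs _ Ht]; last by rewrite mulrDr; exact: I1_spannedD.
by rewrite !mulrA -exprS; exact: I1_monomial.
Qed.

Lemma I1_spanned_d r : I1_spanned r -> I1_spanned (I1_d * r).
Proof.
elim=> [j p k|s t _ Hs _ Ht]; last by rewrite mulrDr; exact: I1_spannedD.
case: j => [|j]; last first.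
  by rewrite exprS !mulrA I1_intK mul1r; exact: I1_monomial.
rewrite mul1r mulrA I1_shiftl -mulrA -exprS -[I1_euler _]mul1r.
exact: (I1_monomial 0).
Qed.

Lemma I1_spanned_euler q r : I1_spanned r -> I1_spanned (I1_euler q * r).
Proof.
elim=> [j p k|s t _ Hs _ Ht]; last by rewrite mulrDr; exact: I1_spannedD.
have [q' E] : exists q', I1_euler q * I1_int ^+ j = I1_int ^+ j * I1_euler q'.
  elim: j q => [|j IH] q; first by exists q; rewrite mulr1 mul1r.
  have [q' E] := IH (q \Po ('X + 1)); exists q'.
  by rewrite exprS mulrA I1_shiftr -[LHS]mulrA E mulrA.
rewrite !mulrA E -(mulrA (I1_int ^+ j)) -rmorphM.
exact: I1_monomial.
Qed.

Lemma I1_spanned_all r : I1_spanned r.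
Proof.
(* The operators that preserve the span by left multiplication form a
   subalgebra that contains the generators. *)
pose A := [pred f : poly_end K | `[< exists2 g : I1 K, val g = f
  & forall h, I1_spanned h -> I1_spanned (g * h) >]].
suff /asboolP[g /val_inj <- Hg] : val r \in A.
  rewrite -[g]mulr1; apply: Hg.
  by have := I1_monomial 0 1 0; rewrite rmorph1 !mulr1.
have /asboolP := valP r; apply; first split.
- by apply/asboolP; exists 1 => // h; rewrite mul1r.
- move=> a f g /asboolP[f' <- Hf] /asboolP[g' <- Hg].
  apply/asboolP; exists (a *: f' + g') => // h Hh.
  rewrite mulrDl -scalerAl; apply: I1_spannedD; last exact: Hg.
  exact/I1_spannedZ/Hf.
- move=> f g /asboolP[f' <- Hf] /asboolP[g' <- Hg].
  apply/asboolP; exists (f' * g') => // h Hh.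
  by rewrite -mulrA; apply/Hf/Hg.
- apply/asboolP; exists I1_x => // h Hh.
  by rewrite I1_xE -mulrA; apply/I1_spanned_int/I1_spanned_euler.
- by apply/asboolP; exists I1_d => // h; exact: I1_spanned_d.
- by apply/asboolP; exists I1_int => // h; exact: I1_spanned_int.
Qed.

Lemma I1_integro_diff : integro_diff I1_euler I1_d I1_int.
Proof.
have natfact_neq0 n : n`!%:R != 0 :> K.
  by rewrite (iffLR (pcharf0P K) charK0) -lt0n fact_gt0.
split.
- exact: I1_intK.
- exact: I1_shiftl.
- exact: I1_shiftr.
- move=> p; apply: act_ext => n; rewrite !actM act_eval0 !actZr.
  by rewrite !act_euler hornerC.
- move=> p; apply: act_ext => n; rewrite !actM !act_euler !actZr act_eval0.
  by rewrite coefXn; case: n => [|n]; rewrite ?hornerC // scale0r !scaler0.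
- move=> /(congr1 (fun f => act f 'X^0)).
  rewrite actM act_d scale0r -(scale0r 0) actZr scale0r => /eqP.
  by rewrite eq_sym oner_eq0.
- move=> P PD Pm r; elim: (I1_spanned_all r) => [j p k|s t _ Ps _ Pt].
    exact: Pm.
  exact: PD.
- move=> r Hr; apply: act_ext => n; rewrite act0.
  have /eqP := congr1 (fun f => act f 'X^0) (Hr n).
  rewrite 2!actM act_eval0 coefXn scale1r act_expint actZr act0.
  by rewrite scaler_eq0 invr_eq0 (negbTE (natfact_neq0 n)) => /eqP.
- move=> r Hr; apply: act_ext => m; rewrite act0; apply/polyP => n.
  have := congr1 (fun f => (act f 'X^m)`_0) (Hr n).
  rewrite 2!actM act_eval0 act_expd coefZ coefXn mulr1 coef_derivn addn0.
  rewrite ffactnn act0 !coef0 -mulr_natr => /eqP.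
  by rewrite mulf_eq0 (negbTE (natfact_neq0 n)) orbF => /eqP.
Qed.

End I1Presentation.

Theorem theorem1p2 (K : fieldType) (charK0 : [pchar K]%R =i pred0) :
  weak_dim_is (Ql (I1 K)) 0 /\ weak_dim_is (Qr (I1 K)) 0.
Proof.
have HI := I1_integro_diff charK0; have [psi HIc] := integro_diff_converse HI.
split; apply: vnr_weak_dim0 => q.
  exact: (integro_diff_Ql_vnr charK0 HI erefl).
have [y Hy] : @vn_regular (Ql (I1 K)^c) q.
  exact: (integro_diff_Ql_vnr charK0 HIc erefl).
by exists y; apply: etrans Hy; exact: (@mulrA (Ql (I1 K)^c) q y q).
Qed.
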